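(* Let $(\mathfrak{A},\mathsf{L}_{\mathfrak{A}})$ and $(\mathfrak{B},\mathsf{L}_{\mathfrak{B}})$ be Leibniz quantum compact metric spaces. If $\Lambda((\mathfrak{A},\mathsf{L}_{\mathfrak{A}}),(\mathfrak{B},\mathsf{L}_{\mathfrak{B}}))=0$, then there exists a *-isomorphism $h:\mathfrak{A}\to\mathfrak{B}$ such that $\mathsf{L}_{\mathfrak{B}}\circ h=\mathsf{L}_{\mathfrak{A}}$ on $\mathfrak{sa}(\mathfrak{A})$ (with the convention that Lip-norms take the value $\infty$ outside their domains).
   Context: Notation: $\mathfrak{sa}(\mathfrak{A})$ self-adjoint part, $\mathscr{S}(\mathfrak{A})$ state space. Quantum compact metric space $(\mathfrak{A},\mathsf{L})$: unital C*-algebra with a seminorm $\mathsf{L}$ on a dense subspace $\mathrm{dom}(\mathsf{L})\subseteq\mathfrak{sa}(\mathfrak{A})$ ($\mathsf{L}=\infty$ elsewhere), vanishing exactly on $\mathbb{R}1_{\mathfrak{A}}$, such that $\mathrm{mk}_{\mathsf{L}}(\varphi,\psi)=\sup\{|\varphi(a)-\psi(a)|:a\in\mathfrak{sa}(\mathfrak{A}),\mathsf{L}(a)\le1\}$ metrizes the weak* topology on $\mathscr{S}(\mathfrak{A})$. A Leibniz quantum compact metric space is a quantum compact metric space with $\mathsf{L}$ lower semi-continuous for the norm and, for all $a,b\in\mathfrak{sa}(\mathfrak{A})$, $\mathsf{L}(\frac{ab+ba}{2})\le\|a\|\mathsf{L}(b)+\|b\|\mathsf{L}(a)$ and $\mathsf{L}(\frac{ab-ba}{2i})\le\|a\|\mathsf{L}(b)+\|b\|\mathsf{L}(a)$;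 $\mathcal{L}^*$ is the class of all of them. $\mathrm{Lip}_1(\mathfrak{A},\mathsf{L})=\{a\in\mathfrak{sa}(\mathfrak{A}):\mathsf{L}(a)\le1\}$. $1$-level: $\mathscr{S}_1(\omega)=\{\varphi\in\mathscr{S}(\mathfrak{D}):\varphi((1-\omega)^*(1-\omega))=0=\varphi((1-\omega)(1-\omega)^* )\}$. Bridge from $\mathfrak{A}$ to $\mathfrak{B}$: $\gamma=(\mathfrak{D},\omega,\pi_{\mathfrak{A}},\pi_{\mathfrak{B}})$ with $\mathfrak{D}$ a unital C*-algebra, $\omega\in\mathfrak{D}$ with $\mathscr{S}_1(\omega)\ne\emptyset$, $\pi_{\mathfrak{A}},\pi_{\mathfrak{B}}$ unital injective *-homomorphisms into $\mathfrak{D}$. Reach: norm-Hausdorff distance in $\mathfrak{D}$ between $\pi_{\mathfrak{A}}(\mathrm{Lip}_1(\mathfrak{A},\mathsf{L}_{\mathfrak{A}}))\omega$ and $\omega\pi_{\mathfrak{B}}(\mathrm{Lip}_1(\mathfrak{B},\mathsf{L}_{\mathfrak{B}}))$. Height: $\max\{\mathrm{Haus}_{\mathrm{mk}_{\mathsf{L}_{\mathfrak{A}}}}(\mathscr{S}(\mathfrak{A}),\{\varphi\circ\pi_{\mathfrak{A}}:\varphi\in\mathscr{S}_1(\omega)\}),\mathrm{Haus}_{\mathrm{mk}_{\mathsf{L}_{\mathfrak{B}}}}(\mathscr{S}(\mathfrak{B}),\{\varphi\circ\pi_{\mathfrak{B}}:\varphi\in\mathscr{S}_1(\omega)\})\}$.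 Length of $\gamma$: maximum of reach and height. An $\mathcal{L}^*$-trek from $(\mathfrak{A},\mathsf{L}_{\mathfrak{A}})$ to $(\mathfrak{B},\mathsf{L}_{\mathfrak{B}})$: a tuple $(\mathfrak{A}_j,\mathsf{L}_j,\gamma_j,\mathfrak{A}_{j+1},\mathsf{L}_{j+1}: j=1,\dots,n)$, $n\ge1$, with $(\mathfrak{A}_1,\mathsf{L}_1)=(\mathfrak{A},\mathsf{L}_{\mathfrak{A}})$, $(\mathfrak{A}_{n+1},\mathsf{L}_{n+1})=(\mathfrak{B},\mathsf{L}_{\mathfrak{B}})$, each $(\mathfrak{A}_j,\mathsf{L}_j)\in\mathcal{L}^*$ and $\gamma_j$ a bridge from $\mathfrak{A}_j$ to $\mathfrak{A}_{j+1}$; its length is the sum of the lengths of the $\gamma_j$ computed for $(\mathsf{L}_j,\mathsf{L}_{j+1})$. The quantum Gromov-Hausdorff propinquity $\Lambda$ between two members of $\mathcal{L}^*$ is the infimum of lengths of all $\mathcal{L}^*$-treks between them. *)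

(* Defs.v *)
From Stdlib Require Import Reals Lra List.
Open Scope R_scope.

Record Cplx : Type := mkC { re : R; im : R }.
Definition Cadd (x y : Cplx) : Cplx := mkC (re x + re y) (im x + im y).
Definition Cmul (x y : Cplx) : Cplx :=
  mkC (re x * re y - im x * im y) (re x * im y + im x * re y).
Definition Cconj (x : Cplx) : Cplx := mkC (re x) (- im x).
Definition CofR (r : R) : Cplx := mkC r 0.
Definition Cabs (x : Cplx) : R := sqrt (re x * re x + im x * im x).
Definition Czero : Cplx := CofR 0.
Definition Cone : Cplx := CofR 1.
Definition Ci : Cplx := mkC 0 1.
Definition Csub (x y : Cplx) : Cplx := mkC (re x - re y) (im x - im y).

Record CStarAlg : Type := {
  car :> Type;
  zero : car; one : car;
  add : car -> car -> car; opp : car -> car;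
  mul : car -> car -> car; smul : Cplx -> car -> car;
  star : car -> car; norm : car -> R;
  add_assoc : forall x y z, add x (add y z) = add (add x y) z;
  add_comm : forall x y, add x y = add y x;
  add_zero : forall x, add x zero = x;
  add_opp : forall x, add x (opp x) = zero;
  smul_one : forall x, smul Cone x = x;
  smul_smul : forall c d x, smul c (smul d x) = smul (Cmul c d) x;
  smul_addl : forall c d x, smul (Cadd c d) x = add (smul c x) (smul d x);
  smul_addr : forall c x y, smul c (add x y) = add (smul c x) (smul c y);
  mul_assoc : forall x y z, mul x (mul y z) = mul (mul x y) z;
  mul_one_l : forall x, mul one x = x;
  mul_one_r : forall x, mul x one = x;
  mul_addl : forall x y z, mul (add x y) z = add (mul x z) (mul y z);
  mul_addr : forall x y z, mul x (add y z) = add (mul x y) (mul x z);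
  mul_smul_l : forall c x y, mul (smul c x) y = smul c (mul x y);
  mul_smul_r : forall c x y, mul x (smul c y) = smul c (mul x y);
  star_star : forall x, star (star x) = x;
  star_add : forall x y, star (add x y) = add (star x) (star y);
  star_smul : forall c x, star (smul c x) = smul (Cconj c) (star x);
  star_mul : forall x y, star (mul x y) = mul (star y) (star x);
  norm_nonneg : forall x, 0 <= norm x;
  norm_eq0 : forall x, norm x = 0 -> x = zero;
  norm_triangle : forall x y, norm (add x y) <= norm x + norm y;
  norm_smul : forall c x, norm (smul c x) = Cabs c * norm x;
  norm_mul : forall x y, norm (mul x y) <= norm x * norm y;
  norm_cstar : forall x, norm (mul (star x) x) = norm x * norm x;
  complete : forall u : nat -> car,
    (forall eps, 0 < eps -> exists N, forall m n, (N <= m)%nat -> (N <= n)%nat ->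
        norm (add (u m) (opp (u n))) < eps) ->
    exists l, forall eps, 0 < eps -> exists N, forall n, (N <= n)%nat ->
        norm (add (u n) (opp l)) < eps
}.

Arguments zero {_}. Arguments one {_}. Arguments add {_}. Arguments opp {_}.
Arguments mul {_}. Arguments smul {_}. Arguments star {_}. Arguments norm {_}.

Definition sub {A : CStarAlg} (x y : A) : A := add x (opp y).
Definition rsmul {A : CStarAlg} (r : R) (x : A) : A := smul (CofR r) x.

Definition selfadj {A : CStarAlg} (a : A) : Prop := star a = a.

(* states: positive linear functionals of norm one; for a unital
   C*-algebra, a positive linear functional has norm phi(1), so
   norm one is phi(1) = 1. *)
Definition is_state {A : CStarAlg} (phi : A -> Cplx) : Prop :=
  (forall x y, phi (add x y) = Cadd (phi x) (phi y)) /\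
  (forall c x, phi (smul c x) = Cmul c (phi x)) /\
  (forall x, im (phi (mul (star x) x)) = 0 /\ 0 <= re (phi (mul (star x) x))) /\
  phi one = Cone.

(* extended non-negative reals [0, oo]: None = oo *)
Definition ext := option R.

Definition lip_le {A : CStarAlg} (L : A -> ext) (a : A) (r : R) : Prop :=
  exists l, L a = Some l /\ l <= r.

Definition mk_le {A : CStarAlg} (L : A -> ext) (phi psi : A -> Cplx) (r : R) : Prop :=
  forall a, selfadj a -> lip_le L a 1 -> Cabs (Csub (phi a) (psi a)) <= r.

Definition mk_lt {A : CStarAlg} (L : A -> ext) (phi psi : A -> Cplx) (r : R) : Prop :=
  exists s, s < r /\ mk_le L phi psi s.

Definition mk_open {A : CStarAlg} (L : A -> ext) (U : (A -> Cplx) -> Prop) : Prop :=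
  forall phi, is_state phi -> U phi -> exists eps, 0 < eps /\
    forall psi, is_state psi -> mk_lt L phi psi eps -> U psi.

Definition weakstar_open {A : CStarAlg} (U : (A -> Cplx) -> Prop) : Prop :=
  forall phi, is_state phi -> U phi -> exists (F : list A) (eps : R), 0 < eps /\
    forall psi, is_state psi ->
      (forall a, In a F -> Cabs (Csub (psi a) (phi a)) < eps) -> U psi.

Definition is_LQCMS (A : CStarAlg) (L : A -> ext) : Prop :=
  (forall a, L a <> None -> selfadj a) /\
  (forall a b la lb, L a = Some la -> L b = Some lb ->
     exists l, L (add a b) = Some l /\ l <= la + lb) /\
  (forall r a la, L a = Some la -> L (rsmul r a) = Some (Rabs r * la)) /\
  (forall a la, L a = Some la -> 0 <= la) /\
  (forall a, selfadj a -> forall eps, 0 < eps ->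
     exists b, L b <> None /\ norm (sub a b) < eps) /\
  (forall a, L a = Some 0 <-> exists r : R, a = rsmul r one) /\
  (forall phi psi, is_state phi -> is_state psi -> exists r, mk_le L phi psi r) /\
  (forall U : (A -> Cplx) -> Prop, mk_open L U <-> weakstar_open U) /\
  (forall (u : nat -> A) (a : A) (r : R),
     (forall eps, 0 < eps -> exists N, forall n, (N <= n)%nat -> norm (sub (u n) a) < eps) ->
     (forall n, lip_le L (u n) r) -> lip_le L a r) /\
  (forall a b la lb, selfadj a -> selfadj b -> L a = Some la -> L b = Some lb ->
     lip_le L (rsmul (/2) (add (mul a b) (mul b a))) (norm a * lb + norm b * la) /\
     lip_le L (smul (mkC 0 (-(/2))) (sub (mul a b) (mul b a))) (norm a * lb + norm b * la)).

Record LQCMS : Type := {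
  alg :> CStarAlg;
  lip : alg -> ext;
  lqcms_prop : is_LQCMS alg lip
}.

Definition unital_inj_star_hom {A D : CStarAlg} (p : A -> D) : Prop :=
  (forall x y, p (add x y) = add (p x) (p y)) /\
  (forall c x, p (smul c x) = smul c (p x)) /\
  (forall x y, p (mul x y) = mul (p x) (p y)) /\
  (forall x, p (star x) = star (p x)) /\
  p one = one /\
  (forall x y, p x = p y -> x = y).

Definition one_level {D : CStarAlg} (w : D) (phi : D -> Cplx) : Prop :=
  is_state phi /\
  phi (mul (star (sub one w)) (sub one w)) = Czero /\
  phi (mul (sub one w) (star (sub one w))) = Czero.

Record Bridge (A B : CStarAlg) : Type := {
  br_D : CStarAlg;
  br_w : br_D;
  br_pA : A -> br_D;
  br_pB : B -> br_D;
  br_level : exists phi, one_level br_w phi;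
  br_pA_hom : unital_inj_star_hom br_pA;
  br_pB_hom : unital_inj_star_hom br_pB
}.
Arguments br_D {_ _}. Arguments br_w {_ _}. Arguments br_pA {_ _}. Arguments br_pB {_ _}.

(* Hausdorff distance <= r for subsets X, Y of a set with distance d
   (possibly infinite via the predicate dle) : every point of X is within
   distance <= r of Y and vice versa, i.e. sup_x inf_y d(x,y) <= r. *)
Definition haus_le {T : Type} (dlt : T -> T -> R -> Prop)
  (X Y : T -> Prop) (r : R) : Prop :=
  (forall x, X x -> forall s, r < s -> exists y, Y y /\ dlt x y s) /\
  (forall y, Y y -> forall s, r < s -> exists x, X x /\ dlt x y s).

Definition norm_lt {D : CStarAlg} (x y : D) (s : R) : Prop := norm (sub x y) < s.

Definition reach_le {X Y : LQCMS} (g : Bridge X Y) (r : R) : Prop :=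
  haus_le norm_lt
    (fun d => exists a, selfadj a /\ lip_le (lip X) a 1 /\ d = mul (br_pA g a) (br_w g))
    (fun d => exists b, selfadj b /\ lip_le (lip Y) b 1 /\ d = mul (br_w g) (br_pB g b))
    r.

Definition height_le {X Y : LQCMS} (g : Bridge X Y) (r : R) : Prop :=
  haus_le (fun phi psi s => mk_lt (lip X) phi psi s)
    (fun phi : X -> Cplx => is_state phi)
    (fun phi => exists f, one_level (br_w g) f /\ phi = fun a => f (br_pA g a)) r /\
  haus_le (fun phi psi s => mk_lt (lip Y) phi psi s)
    (fun phi : Y -> Cplx => is_state phi)
    (fun phi => exists f, one_level (br_w g) f /\ phi = fun b => f (br_pB g b)) r.

Definition length_le {X Y : LQCMS} (g : Bridge X Y) (r : R) : Prop :=
  reach_le g r /\ height_le g r.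

(* trek_le X Y r : there is an L*-trek from X to Y whose length (sum of the
   lengths of its bridges) is <= r, witnessed by bounds on each bridge. *)
Inductive trek_le : LQCMS -> LQCMS -> R -> Prop :=
| trek_single : forall (X Y : LQCMS) (g : Bridge X Y) (r : R),
    length_le g r -> trek_le X Y r
| trek_cons : forall (X Y Z : LQCMS) (g : Bridge X Y) (r s : R),
    length_le g r -> trek_le Y Z s -> trek_le X Z (r + s).

(* Lambda(X, Y) = 0 : the infimum of trek lengths is 0 *)
Definition propinquity_zero (X Y : LQCMS) : Prop :=
  forall eps, 0 < eps -> exists r, r < eps /\ trek_le X Y r.

Definition star_iso {A B : CStarAlg} (h : A -> B) : Prop :=
  (forall x y, h (add x y) = add (h x) (h y)) /\
  (forall c x, h (smul c x) = smul c (h x)) /\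
  (forall x y, h (mul x y) = mul (h x) (h y)) /\
  (forall x, h (star x) = star (h x)) /\
  (forall x y, h x = h y -> x = y) /\
  (forall y, exists x, h x = y).

(* Main.v *)
(** A correspondence of defect [s] between two Lipschitz-normed algebras relates
    self-adjoint elements at a common Lipschitz level [l], preserves norms up to
    [2 l s], and is stable under sums and Jordan and Lie products.  A bridge gives
    one: relate [a] and [b] when [pi_A(a) w] is within [l s] of [w pi_B(b)].  States
    in the 1-level satisfy [phi(w x) = phi(x) = phi(x w)], so they cannot separate
    [pi_A(a)] from [pi_B(b)] by more than [l s], and the height transfers this to all
    states.  Correspondences compose along treks with added defects.

    If the propinquity vanishes there are correspondences of defect [1/(n+1)] for all
    [n].  Lipschitz balls are norm-compact (Arzela-Ascoli on the state space, which
    is totally bounded for the Monge-Kantorovich metric), so these correspondences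
    have a limit along an ultrafilter.  With defect zero the limit is isometric,
    hence the graph of an isomorphism of Jordan-Lie algebras preserving the Lip-norm;
    taking closures and complexifying gives the *-isomorphism.

    The norm of a self-adjoint element is the supremum of its values on states by
    Hahn-Banach, once [x* x] is known to be positive (Fukamiya, Kelley-Vaught). *)

From mathcomp Require boolp classical_sets filter.
Require Import Defs.
From Stdlib Require Import Reals Lra Lia List Classical ClassicalEpsilon.
Open Scope R_scope.

(** Jordan and Lie products are used because Lipschitz levels exist only for self-adjoint elements,
    and [a b] need not be self-adjoint; together the two products recover it. The level of a product
    depends on the norms of the factors, so every related pair carries an explicit level, and the
    bounds [K] in the Leibniz clause must dominate the norms met along the whole trek. This is what
    the surplus [2 l s] in that clause pays for. The intermediate algebras of a trek change with the
    prescribed accuracy and are not controlled in any way. What survives composition is the defect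
    and the levels, neither of which depends on the number of bridges. A single ultrafilter makes
    all limits exist at once and lets them commute with the algebraic operations, in place of a
    diagonal extraction over a countable dense set. Positivity is encoded by a norm inequality and
    square roots come from an explicit iteration, in place of spectral theory and functional
    calculus; commutation with roots is therefore carried along by hand. *)

Lemma Cplx_ext (x y : Cplx) : re x = re y -> im x = im y -> x = y.
Proof. destruct x, y; simpl; congruence. Qed.

Lemma add_cancel_l {A : CStarAlg} (x y z : A) : add x y = add x z -> y = z.
Proof.
  intros H.
  rewrite <- (add_zero A y), <- (add_zero A z), <- (add_opp A x), !add_assoc.
  now rewrite (add_comm A y), (add_comm A z), H.
Qed.

Lemma smul_zero_l {A : CStarAlg} (x : A) : smul Czero x = zero.
Proof.
  apply add_cancel_l with (smul Czero x).
  rewrite <- smul_addl, add_zero. f_equal. apply Cplx_ext; simpl; ring.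
Qed.

Lemma smul_zero_r {A : CStarAlg} (c : Cplx) : smul c (@zero A) = zero.
Proof.
  apply add_cancel_l with (smul c zero).
  now rewrite <- smul_addr, !add_zero.
Qed.

Lemma opp_smul {A : CStarAlg} (x : A) : opp x = smul (CofR (-1)) x.
Proof.
  apply add_cancel_l with x. rewrite add_opp.
  rewrite <- (smul_one A x) at 1. rewrite <- smul_addl, <- (smul_zero_l x).
  f_equal. apply Cplx_ext; simpl; ring.
Qed.

Lemma mul_zero_l {A : CStarAlg} (x : A) : mul zero x = zero.
Proof. rewrite <- (smul_zero_l zero) at 1. now rewrite mul_smul_l, smul_zero_l. Qed.

Lemma mul_zero_r {A : CStarAlg} (x : A) : mul x zero = zero.
Proof. rewrite <- (smul_zero_l zero) at 1. now rewrite mul_smul_r, smul_zero_l. Qed.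

Lemma star_zero {A : CStarAlg} : star (@zero A) = zero.
Proof.
  rewrite <- (smul_zero_l zero) at 1. rewrite star_smul.
  replace (Cconj Czero) with Czero by (apply Cplx_ext; simpl; ring). apply smul_zero_l.
Qed.

Lemma star_one {A : CStarAlg} : star (@one A) = one.
Proof.
  rewrite <- (mul_one_l A (star one)).
  rewrite <- (star_star A one) at 1. rewrite <- star_mul, mul_one_l.
  apply star_star.
Qed.

(** * Noncommutative *-polynomial identities by reflection *)

Inductive ncexp : Type :=
| Ezero | Eone
| Eatom (sa : bool) (n : nat)
| Eadd (e f : ncexp) | Eopp (e : ncexp) | Emul (e f : ncexp)
| Esmul (c : Cplx) (e : ncexp) | Estar (e : ncexp).

(* A letter is an atom number with a flag: [None] for a self-adjoint atom,
   [Some b] for a general atom, starred when [b] is true. *)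
Definition letter : Type := (nat * option bool)%type.
Definition ncpoly : Type := list (Cplx * list letter).

Fixpoint nc_eval {A : CStarAlg} (env : list A) (e : ncexp) : A :=
  match e with
  | Ezero => zero
  | Eone => one
  | Eatom _ n => nth n env zero
  | Eadd e f => add (nc_eval env e) (nc_eval env f)
  | Eopp e => opp (nc_eval env e)
  | Emul e f => mul (nc_eval env e) (nc_eval env f)
  | Esmul c e => smul c (nc_eval env e)
  | Estar e => star (nc_eval env e)
  end.

Fixpoint nc_wf {A : CStarAlg} (env : list A) (e : ncexp) : Prop :=
  match e with
  | Ezero | Eone => True
  | Eatom sa n => if sa then selfadj (nth n env zero) else True
  | Eadd e f | Emul e f => nc_wf env e /\ nc_wf env f
  | Eopp e | Esmul _ e | Estar e => nc_wf env e
  end.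

Definition letter_star (l : letter) : letter :=
  match l with
  | (n, None) => (n, None)
  | (n, Some b) => (n, Some (if b then false else true))
  end.

(** A private copy of [app], which [nc] can unfold by name in its [cbn] calls while appends in other
    terms stay folded. *)
Fixpoint nc_app {T : Type} (p q : list T) : list T :=
  match p with nil => q | x :: p => x :: nc_app p q end.

Fixpoint word_star (w : list letter) : list letter :=
  match w with
  | nil => nil
  | l :: w => nc_app (word_star w) (letter_star l :: nil)
  end.

Fixpoint poly_smul (c : Cplx) (p : ncpoly) : ncpoly :=
  match p with
  | nil => nil
  | (d, w) :: p => (Cmul c d, w) :: poly_smul c p
  end.

Fixpoint poly_monom (c : Cplx) (w : list letter) (p : ncpoly) : ncpoly :=
  match p with
  | nil => nil
  | (d, v) :: p => (Cmul c d, nc_app w v) :: poly_monom c w p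
  end.

Fixpoint poly_mul (p q : ncpoly) : ncpoly :=
  match p with
  | nil => nil
  | (c, w) :: p => nc_app (poly_monom c w q) (poly_mul p q)
  end.

Fixpoint poly_star (p : ncpoly) : ncpoly :=
  match p with
  | nil => nil
  | (c, w) :: p => (Cconj c, word_star w) :: poly_star p
  end.

Fixpoint nc_poly (e : ncexp) : ncpoly :=
  match e with
  | Ezero => nil
  | Eone => (Cone, nil) :: nil
  | Eatom sa n => (Cone, (n, if sa then None else Some false) :: nil) :: nil
  | Eadd e f => nc_app (nc_poly e) (nc_poly f)
  | Eopp e => poly_smul (CofR (-1)) (nc_poly e)
  | Emul e f => poly_mul (nc_poly e) (nc_poly f)
  | Esmul c e => poly_smul c (nc_poly e)
  | Estar e => poly_star (nc_poly e)
  end.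

Definition flag_eqb (a b : option bool) : bool :=
  match a, b with
  | None, None | Some true, Some true | Some false, Some false => true
  | _, _ => false
  end.

Fixpoint word_eqb (v w : list letter) : bool :=
  match v, w with
  | nil, nil => true
  | (m, a) :: v, (n, b) :: w =>
      if Nat.eqb m n then if flag_eqb a b then word_eqb v w else false else false
  | _, _ => false
  end.

Fixpoint poly_insert (c : Cplx) (w : list letter) (p : ncpoly) : ncpoly :=
  match p with
  | nil => (c, w) :: nil
  | (d, v) :: p =>
      if word_eqb w v then (Cadd c d, v) :: p else (d, v) :: poly_insert c w p
  end.

Fixpoint poly_collect (p : ncpoly) : ncpoly :=
  match p with
  | nil => nil
  | (c, w) :: p => poly_insert c w (poly_collect p)
  end.

(** Coefficients are symbolic real expressions, so their vanishing is a proposition left to [ring]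
    or [field]; only words are compared by computation. *)
Fixpoint poly_null (p : ncpoly) : Prop :=
  match p with
  | nil => True
  | (c, _) :: p => (re c = 0 /\ im c = 0) /\ poly_null p
  end.

Section NcSound.
Context {A : CStarAlg} (env : list A).

Definition letter_eval (l : letter) : A :=
  match l with
  | (n, Some true) => star (nth n env zero)
  | (n, _) => nth n env zero
  end.

Definition letter_wf (l : letter) : Prop :=
  match l with
  | (n, None) => selfadj (nth n env zero)
  | _ => True
  end.

Fixpoint word_eval (w : list letter) : A :=
  match w with nil => one | l :: w => mul (letter_eval l) (word_eval w) end.

Fixpoint poly_eval (p : ncpoly) : A :=
  match p with
  | nil => zero
  | (c, w) :: p => add (smul c (word_eval w)) (poly_eval p)
  end.

Lemma nc_app_app {T : Type} (p q : list T) : nc_app p q = p ++ q.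
Proof. induction p; simpl; congruence. Qed.

Lemma add_zero_l (x : A) : add zero x = x.
Proof. now rewrite add_comm, add_zero. Qed.

Lemma word_eval_app (v w : list letter) :
  word_eval (v ++ w) = mul (word_eval v) (word_eval w).
Proof.
  induction v; simpl; [now rewrite mul_one_l | now rewrite IHv, mul_assoc].
Qed.

Lemma poly_eval_app (p q : ncpoly) :
  poly_eval (p ++ q) = add (poly_eval p) (poly_eval q).
Proof.
  induction p as [|[c w] p IH]; simpl; [now rewrite add_zero_l|].
  now rewrite IH, add_assoc.
Qed.

Lemma poly_eval_smul (c : Cplx) (p : ncpoly) :
  poly_eval (poly_smul c p) = smul c (poly_eval p).
Proof.
  induction p as [|[d w] p IH]; simpl; [now rewrite smul_zero_r|].
  now rewrite IH, smul_addr, smul_smul.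
Qed.

Lemma poly_eval_monom (c : Cplx) (w : list letter) (p : ncpoly) :
  poly_eval (poly_monom c w p) = mul (smul c (word_eval w)) (poly_eval p).
Proof.
  induction p as [|[d v] p IH]; simpl; [now rewrite mul_zero_r|].
  rewrite IH, mul_addr, !mul_smul_l, mul_smul_r, smul_smul.
  now rewrite nc_app_app, word_eval_app.
Qed.

Lemma poly_eval_mul (p q : ncpoly) :
  poly_eval (poly_mul p q) = mul (poly_eval p) (poly_eval q).
Proof.
  induction p as [|[c w] p IH]; simpl; [now rewrite mul_zero_l|].
  now rewrite nc_app_app, poly_eval_app, poly_eval_monom, IH, mul_addl.
Qed.

Lemma letter_eval_star (l : letter) : letter_wf l ->
  letter_eval (letter_star l) = star (letter_eval l).
Proof.
  destruct l as [n [[|]|]]; simpl; intros H; auto.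
  now rewrite star_star.
Qed.

Lemma word_eval_star (w : list letter) : Forall letter_wf w ->
  word_eval (word_star w) = star (word_eval w).
Proof.
  induction 1; simpl; [now rewrite star_one|].
  rewrite nc_app_app, word_eval_app, IHForall; simpl.
  now rewrite mul_one_r, letter_eval_star, star_mul.
Qed.

Lemma Forall_word_star (w : list letter) :
  Forall letter_wf w -> Forall letter_wf (word_star w).
Proof.
  induction 1; simpl; [constructor|]. rewrite nc_app_app.
  apply Forall_app; split; auto. constructor; auto.
  destruct x as [n [[|]|]]; simpl; auto.
Qed.

Definition poly_wf (p : ncpoly) : Prop := Forall (fun m => Forall letter_wf (snd m)) p.

Lemma poly_eval_star (p : ncpoly) : poly_wf p ->
  poly_eval (poly_star p) = star (poly_eval p).
Proof.
  induction 1 as [|[c w] p H _ IH]; simpl; [now rewrite star_zero|].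
  now rewrite IH, star_add, star_smul, word_eval_star.
Qed.

Lemma nc_poly_wf (e : ncexp) : nc_wf env e -> poly_wf (nc_poly e).
Proof.
  unfold poly_wf.
  assert (Hs : forall c p, poly_wf p -> poly_wf (poly_smul c p)).
  { intros c p; induction 1 as [|[d w] p]; constructor; auto. }
  assert (Hm : forall c w p, Forall letter_wf w -> poly_wf p -> poly_wf (poly_monom c w p)).
  { intros c w p Hw; induction 1 as [|[d v] p]; constructor; auto. simpl.
    rewrite nc_app_app; apply Forall_app; auto. }
  induction e; simpl; intros H.
  - constructor.
  - repeat constructor.
  - destruct sa; repeat constructor; auto.
  - rewrite nc_app_app; apply Forall_app; tauto.
  - exact (Hs _ _ (IHe H)).
  - destruct H as [H1 H2]. specialize (IHe1 H1). specialize (IHe2 H2).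
    induction IHe1 as [|[c w] p]; simpl; [constructor|].
    rewrite nc_app_app; apply Forall_app; split; [apply Hm; auto|auto].
  - exact (Hs _ _ (IHe H)).
  - specialize (IHe H). induction IHe as [|[c w] p]; simpl; constructor; auto.
    apply Forall_word_star; auto.
Qed.

Lemma nc_eval_poly (e : ncexp) : nc_wf env e -> nc_eval env e = poly_eval (nc_poly e).
Proof.
  induction e; simpl; intros H.
  - reflexivity.
  - now rewrite smul_one, add_zero.
  - rewrite smul_one, add_zero, mul_one_r. now destruct sa.
  - now rewrite nc_app_app, poly_eval_app, IHe1, IHe2.
  - now rewrite poly_eval_smul, <- IHe, opp_smul.
  - now rewrite poly_eval_mul, IHe1, IHe2.
  - now rewrite poly_eval_smul, IHe.
  - rewrite poly_eval_star, IHe; auto. apply nc_poly_wf; auto.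
Qed.

Lemma word_eqb_eq (v w : list letter) : word_eqb v w = true -> v = w.
Proof.
  revert w; induction v as [|[m a] v IH]; intros [|[n b] w]; simpl; try easy.
  destruct (Nat.eqb_spec m n); [|easy].
  destruct (flag_eqb a b) eqn:E; [|easy]. intros H. rewrite (IH w H). subst.
  now destruct a as [[|]|], b as [[|]|].
Qed.

Lemma poly_eval_insert (c : Cplx) (w : list letter) (p : ncpoly) :
  poly_eval (poly_insert c w p) = add (smul c (word_eval w)) (poly_eval p).
Proof.
  induction p as [|[d v] p IH]; simpl; [reflexivity|].
  destruct (word_eqb w v) eqn:E; simpl.
  - rewrite (word_eqb_eq _ _ E). now rewrite smul_addl, add_assoc.
  - rewrite IH, !add_assoc. f_equal. apply add_comm.
Qed.

Lemma poly_eval_collect (p : ncpoly) : poly_eval (poly_collect p) = poly_eval p.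
Proof.
  induction p as [|[c w] p IH]; simpl; [reflexivity|].
  now rewrite poly_eval_insert, IH.
Qed.

Lemma poly_eval_null (p : ncpoly) : poly_null p -> poly_eval p = zero.
Proof.
  induction p as [|[c w] p IH]; simpl; [reflexivity|].
  intros [[H1 H2] H]. rewrite IH, add_zero; auto.
  replace c with Czero by (apply Cplx_ext; simpl; congruence).
  apply smul_zero_l.
Qed.

Lemma nc_sound (e f : ncexp) : nc_wf env (Eadd e (Eopp f)) ->
  poly_null (poly_collect (nc_poly (Eadd e (Eopp f)))) -> nc_eval env e = nc_eval env f.
Proof.
  intros Hw Hn. apply poly_eval_null in Hn.
  rewrite poly_eval_collect, <- nc_eval_poly in Hn by exact Hw. simpl in Hn.
  apply add_cancel_l with (opp (nc_eval env f)).
  now rewrite add_comm, Hn, add_comm, add_opp.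
Qed.

End NcSound.

(** * Reification of algebra terms *)

Ltac nc_lookup x l :=
  lazymatch l with
  | x :: _ => constr:(O)
  | _ :: ?l' => let n := nc_lookup x l' in constr:(S n)
  end.

Ltac nc_mem x l :=
  lazymatch l with
  | x :: _ => constr:(true)
  | _ :: ?l' => nc_mem x l'
  | nil => constr:(false)
  end.

Ltac nc_atoms e l :=
  lazymatch e with
  | zero => l
  | one => l
  | add ?x ?y => let l := nc_atoms x l in nc_atoms y l
  | sub ?x ?y => let l := nc_atoms x l in nc_atoms y l
  | mul ?x ?y => let l := nc_atoms x l in nc_atoms y l
  | opp ?x => nc_atoms x l
  | smul _ ?x => nc_atoms x l
  | rsmul _ ?x => nc_atoms x l
  | star ?x => nc_atoms x l
  | _ => lazymatch nc_mem e l with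
         | true => l
         | false => constr:(e :: l)
         end
  end.

Ltac nc_reify l e :=
  lazymatch e with
  | zero => constr:(Ezero)
  | one => constr:(Eone)
  | add ?x ?y => let x := nc_reify l x in let y := nc_reify l y in constr:(Eadd x y)
  | sub ?x ?y => let x := nc_reify l x in let y := nc_reify l y in constr:(Eadd x (Eopp y))
  | mul ?x ?y => let x := nc_reify l x in let y := nc_reify l y in constr:(Emul x y)
  | opp ?x => let x := nc_reify l x in constr:(Eopp x)
  | smul ?c ?x => let x := nc_reify l x in constr:(Esmul c x)
  | rsmul ?r ?x => let x := nc_reify l x in constr:(Esmul (CofR r) x)
  | star ?x => let x := nc_reify l x in constr:(Estar x)
  | _ => let n := nc_lookup e l in
         match goal with
         | _ : selfadj e |- _ => constr:(Eatom true n)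
         | _ => constr:(Eatom false n)
         end
  end.

(* Leaves the coefficient identities it cannot close by [ring] or [field]. *)
Ltac nc :=
  lazymatch goal with
  | |- @eq ?T ?x ?y =>
      let A := lazymatch type of x with car ?A => A end in
      let l := nc_atoms x (@nil (car A)) in
      let l := nc_atoms y l in
      let e := nc_reify l x in
      let f := nc_reify l y in
      change (nc_eval l e = nc_eval l f);
      apply nc_sound;
      [ cbn [nc_wf nth]; repeat split; assumption
      | cbn [nc_poly nc_app poly_smul poly_monom poly_mul poly_star poly_collect
             poly_insert poly_null word_star letter_star word_eqb flag_eqb Nat.eqb];
        cbn [re im Cadd Cmul Cconj CofR Cone Czero Ci];
        repeat split; try ring; try lra; try (field; lra) ]
  end.

(** Reasoning modulo one hypothesis: if [x - y] and [u - v] are the same noncommutative polynomial,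
    then [u = v] yields [x = y]. The hypothesis given to [nc_from] is first scaled to make the two
    polynomials agree. *)
Lemma eq_of_sub_eq {A : CStarAlg} (u v x y : A) : u = v -> sub x y = sub u v -> x = y.
Proof.
  intros -> H. transitivity (add (sub x y) y); [nc|]. rewrite H. nc.
Qed.

Ltac nc_from H := refine (eq_of_sub_eq _ _ _ _ H _); try nc.

(** * Norms and self-adjoint elements *)

Lemma Cabs_CofR (r : R) : Cabs (CofR r) = Rabs r.
Proof.
  unfold Cabs; simpl. replace (r * r + 0 * 0) with (Rsqr r) by (unfold Rsqr; ring).
  apply sqrt_Rsqr_abs.
Qed.

Lemma norm_rsmul {A : CStarAlg} (r : R) (x : A) : norm (rsmul r x) = Rabs r * norm x.
Proof. unfold rsmul. now rewrite norm_smul, Cabs_CofR. Qed.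

Lemma norm_zero {A : CStarAlg} : norm (@zero A) = 0.
Proof.
  replace (@zero A) with (rsmul 0 (@zero A)) by nc.
  rewrite norm_rsmul, Rabs_R0; ring.
Qed.

Lemma norm_sub_sym {A : CStarAlg} (x y : A) : norm (sub x y) = norm (sub y x).
Proof.
  replace (sub x y) with (rsmul (-1) (sub y x)) by nc.
  rewrite norm_rsmul, Rabs_left by lra; ring.
Qed.

Lemma norm_sub_triangle {A : CStarAlg} (x y z : A) :
  norm (sub x z) <= norm (sub x y) + norm (sub y z).
Proof.
  replace (sub x z) with (add (sub x y) (sub y z)) by nc. apply norm_triangle.
Qed.

Lemma norm_le_sub {A : CStarAlg} (x y : A) : norm x <= norm y + norm (sub x y).
Proof.
  replace x with (add y (sub x y)) at 1 by nc. apply norm_triangle.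
Qed.

Lemma sub_eq0 {A : CStarAlg} (x y : A) : norm (sub x y) <= 0 -> x = y.
Proof.
  intros H. pose proof (norm_nonneg A (sub x y)).
  assert (E : sub x y = zero) by (apply norm_eq0; lra).
  nc_from E.
Qed.

(** The C*-identity gives |y|^2 <= |y*| |y|; cancelling |y| and applying the result to x and to x*
    gives both inequalities. *)
Lemma norm_star {A : CStarAlg} (x : A) : norm (star x) = norm x.
Proof.
  assert (H : forall y : A, norm y <= norm (star y)).
  { intros y. pose proof (norm_cstar A y) as E. pose proof (norm_mul A (star y) y).
    pose proof (norm_nonneg A y). pose proof (norm_nonneg A (star y)).
    destruct (Req_dec (norm y) 0); [lra|]. nra. }
  pose proof (H x). pose proof (H (star x)) as H'. rewrite star_star in H'. lra.
Qed.

Lemma norm_one_le {A : CStarAlg} : norm (@one A) <= 1.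
Proof.
  pose proof (norm_cstar A one) as E. rewrite star_one, mul_one_l in E.
  pose proof (norm_nonneg A (@one A)). nra.
Qed.

Lemma norm_selfadj_sq {A : CStarAlg} (a : A) : selfadj a ->
  norm (mul a a) = norm a * norm a.
Proof. intros H. rewrite <- norm_cstar. now rewrite H. Qed.

Lemma selfadj_sq_zero {A : CStarAlg} (a : A) : selfadj a -> mul a a = zero -> a = zero.
Proof.
  intros H E. apply norm_eq0. pose proof (norm_selfadj_sq a H) as N.
  rewrite E, norm_zero in N. pose proof (norm_nonneg A a). nra.
Qed.

Lemma selfadj_zero {A : CStarAlg} : selfadj (@zero A).
Proof. apply star_zero. Qed.
Lemma selfadj_one {A : CStarAlg} : selfadj (@one A).
Proof. apply star_one. Qed.
Lemma selfadj_add {A : CStarAlg} (a b : A) : selfadj a -> selfadj b -> selfadj (add a b).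
Proof. intros; unfold selfadj; nc. Qed.
Lemma selfadj_sub {A : CStarAlg} (a b : A) : selfadj a -> selfadj b -> selfadj (sub a b).
Proof. intros; unfold selfadj; nc. Qed.
Lemma selfadj_rsmul {A : CStarAlg} (r : R) (a : A) : selfadj a -> selfadj (rsmul r a).
Proof. intros; unfold selfadj; nc. Qed.
Lemma selfadj_star_mul {A : CStarAlg} (x : A) : selfadj (mul (star x) x).
Proof. intros; unfold selfadj; nc. Qed.
Lemma selfadj_mul_comm {A : CStarAlg} (a b : A) : selfadj a -> selfadj b ->
  mul a b = mul b a -> selfadj (mul a b).
Proof. intros Ha Hb E; unfold selfadj. rewrite E at 2. nc. Qed.

(** * Convergence along a filter on the natural numbers *)

(** One interface for ordinary limits ([eventually]) and for limits along an ultrafilter, so that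
    continuity of the operations is proved once. Properness is [nf_ex]. *)
Record nat_filter (F : (nat -> Prop) -> Prop) : Prop := {
  nf_all : F (fun _ => True);
  nf_mono : forall P Q : nat -> Prop, (forall n, P n -> Q n) -> F P -> F Q;
  nf_and : forall P Q, F P -> F Q -> F (fun n => P n /\ Q n);
  nf_ex : forall P, F P -> exists n, P n
}.

Definition eventually (P : nat -> Prop) : Prop :=
  exists N, forall n, (N <= n)%nat -> P n.

Lemma eventually_filter : nat_filter eventually.
Proof.
  split.
  - now exists O.
  - intros P Q H [N HN]. exists N; auto.
  - intros P Q [N HN] [M HM]. exists (N + M)%nat. intros; split; [apply HN|apply HM]; lia.
  - intros P [N HN]. exists N; auto.
Qed.

Definition cvg (F : (nat -> Prop) -> Prop) {A : CStarAlg} (u : nat -> A) (l : A) : Prop :=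
  forall eps, 0 < eps -> F (fun n => norm (sub (u n) l) < eps).

Section Cvg.
Context {F : (nat -> Prop) -> Prop} (FF : nat_filter F) {A : CStarAlg}.
Implicit Types (u v : nat -> A) (l m : A).

Lemma nf_and_imp (P Q S : nat -> Prop) :
  (forall n, P n -> Q n -> S n) -> F P -> F Q -> F S.
Proof.
  intros H HP HQ. apply (nf_mono F FF (fun n => P n /\ Q n)).
  - intros n [? ?]; auto.
  - now apply nf_and.
Qed.

Lemma nf_forall (P : nat -> Prop) : (forall n, P n) -> F P.
Proof. intros H. apply (nf_mono F FF (fun _ => True)); auto. apply nf_all; auto. Qed.

Lemma cvg_const l : cvg F (fun _ => l) l.
Proof.
  intros eps He. apply nf_forall. intros _.
  replace (sub l l) with (@zero A) by nc. now rewrite norm_zero.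
Qed.

Lemma cvg_add u v l m : cvg F u l -> cvg F v m -> cvg F (fun n => add (u n) (v n)) (add l m).
Proof.
  intros Hu Hv eps He.
  apply (nf_and_imp _ _ _) with (2 := Hu (eps/2) ltac:(lra)) (3 := Hv (eps/2) ltac:(lra)).
  intros n H1 H2.
  replace (sub (add (u n) (v n)) (add l m)) with (add (sub (u n) l) (sub (v n) m)) by nc.
  pose proof (norm_triangle A (sub (u n) l) (sub (v n) m)). lra.
Qed.

Lemma cvg_smul c u l : cvg F u l -> cvg F (fun n => smul c (u n)) (smul c l).
Proof.
  intros Hu eps He.
  assert (Hc : 0 <= Cabs c) by apply sqrt_pos.
  assert (Hd : 0 < eps / (Cabs c + 1)) by (apply Rdiv_lt_0_compat; lra).
  apply (nf_mono F FF) with (2 := Hu _ Hd). intros n H.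
  replace (sub (smul c (u n)) (smul c l)) with (smul c (sub (u n) l)) by nc.
  rewrite norm_smul. pose proof (norm_nonneg A (sub (u n) l)).
  apply Rle_lt_trans with ((Cabs c + 1) * norm (sub (u n) l)); [nra|].
  apply Rmult_lt_compat_l with (r := Cabs c + 1) in H; [|lra].
  replace ((Cabs c + 1) * (eps / (Cabs c + 1))) with eps in H by (field; lra). lra.
Qed.

Lemma cvg_sub u v l m : cvg F u l -> cvg F v m -> cvg F (fun n => sub (u n) (v n)) (sub l m).
Proof.
  intros Hu Hv. unfold sub.
  intros eps He. pose proof (cvg_add _ _ _ _ Hu (cvg_smul (CofR (-1)) _ _ Hv) eps He) as H.
  apply (nf_mono F FF) with (2 := H). intros n. now rewrite !opp_smul.
Qed.

Lemma cvg_star u l : cvg F u l -> cvg F (fun n => star (u n)) (star l).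
Proof.
  intros Hu eps He. apply (nf_mono F FF) with (2 := Hu eps He). intros n.
  replace (sub (star (u n)) (star l)) with (star (sub (u n) l)) by nc.
  now rewrite norm_star.
Qed.

Lemma cvg_mul u v l m : cvg F u l -> cvg F v m -> cvg F (fun n => mul (u n) (v n)) (mul l m).
Proof.
  intros Hu Hv eps He.
  pose proof (norm_nonneg A l) as Hl. pose proof (norm_nonneg A m) as Hm.
  (* The bound [d <= 1] gives |u n| <= |l| + 1, so the error is at most d (|l| + 1 + |m|); the
     further 1 in the denominator makes the final inequality strict. *)
  set (d := Rmin 1 (eps / (norm l + norm m + 2))).
  assert (Hd : 0 < d).
  { apply Rmin_glb_lt; [lra|]. apply Rdiv_lt_0_compat; lra. }
  assert (Hd1 : d <= 1) by apply Rmin_l.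
  assert (Hd2 : d * (norm l + norm m + 2) <= eps).
  { apply Rle_trans with (eps / (norm l + norm m + 2) * (norm l + norm m + 2)).
    - apply Rmult_le_compat_r; [lra|]. apply Rmin_r.
    - right; field; lra. }
  apply (nf_and_imp _ _ _) with (2 := Hu d Hd) (3 := Hv d Hd).
  intros n H1 H2.
  replace (sub (mul (u n) (v n)) (mul l m))
    with (add (mul (u n) (sub (v n) m)) (mul (sub (u n) l) m)) by nc.
  pose proof (norm_triangle A (mul (u n) (sub (v n) m)) (mul (sub (u n) l) m)).
  pose proof (norm_mul A (u n) (sub (v n) m)). pose proof (norm_mul A (sub (u n) l) m).
  pose proof (norm_le_sub (u n) l).
  pose proof (norm_nonneg A (u n)). pose proof (norm_nonneg A (sub (v n) m)).
  pose proof (norm_nonneg A (sub (u n) l)).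
  assert (norm (u n) * norm (sub (v n) m) <= (norm l + 1) * d) by nra.
  assert (norm (sub (u n) l) * norm m <= d * norm m) by nra.
  nra.
Qed.

Lemma cvg_unique u l m : cvg F u l -> cvg F u m -> l = m.
Proof.
  intros Hl Hm. apply sub_eq0. apply Rnot_lt_le. intros H.
  destruct (nf_ex F FF _ (nf_and F FF _ _ (Hl _ (Rlt_mult_inv_pos _ 2 H ltac:(lra)))
    (Hm _ (Rlt_mult_inv_pos _ 2 H ltac:(lra))))) as [n [H1 H2]].
  pose proof (norm_sub_triangle l (u n) m). rewrite (norm_sub_sym l (u n)) in H0. lra.
Qed.

Lemma cvg_norm_le u l c : cvg F u l -> F (fun n => norm (u n) <= c) -> norm l <= c.
Proof.
  intros Hl Hc. apply Rnot_lt_le. intros H.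
  destruct (nf_ex F FF _ (nf_and F FF _ _ (Hl (norm l - c) ltac:(lra)) Hc)) as [n [H1 H2]].
  pose proof (norm_le_sub l (u n)). rewrite (norm_sub_sym l) in H0. lra.
Qed.

Lemma cvg_ext u v l : (forall n, u n = v n) -> cvg F u l -> cvg F v l.
Proof. intros E H eps He. apply (nf_mono F FF) with (2 := H eps He). intros n. now rewrite E. Qed.

End Cvg.

(** * Square roots and positive elements *)

Lemma Un_cv_cvg_dominated {A : CStarAlg} (u : nat -> A) (t : nat -> R) (l : R) :
  Un_cv t l -> (forall n m, norm (sub (u (n + m)%nat) (u n)) <= t (n + m)%nat - t n) ->
  exists x, cvg eventually u x.
Proof.
  intros Ht Hu. apply (complete A). intros eps He.
  destruct (CV_Cauchy t (exist _ l Ht) eps He) as [N HN]. exists N.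
  assert (H : forall m n, (N <= m)%nat -> (m <= n)%nat -> norm (sub (u n) (u m)) < eps).
  { intros m n Hm Hn. replace n with (m + (n - m))%nat by lia.
    eapply Rle_lt_trans; [apply Hu|].
    eapply Rle_lt_trans; [apply Rle_abs|]. apply HN; lia. }
  intros m n Hm Hn. fold (sub (u m) (u n)).
  destruct (Nat.le_ge_cases m n); [rewrite norm_sub_sym|]; apply H; auto.
Qed.

Section SqrtIteration.
Context {A : CStarAlg} (k : A) (Hk : selfadj k) (Nk : norm k <= 1).

Fixpoint sqrt_iter (n : nat) : A :=
  match n with
  | O => zero
  | S n => rsmul (/2) (add k (mul (sqrt_iter n) (sqrt_iter n)))
  end.

(** The same iteration for the scalar k = 1. It is bounded and increasing, and it dominates both the
    norms and the increments of [sqrt_iter]; this settles convergence without a geometric rate,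
    which fails in the extreme case |k| = 1. *)
Fixpoint sqrt_bound (n : nat) : R :=
  match n with
  | O => 0
  | S n => (1 + sqrt_bound n * sqrt_bound n) / 2
  end.

Lemma sqrt_bound_range n : 0 <= sqrt_bound n <= 1.
Proof. induction n; simpl; nra. Qed.

Lemma sqrt_bound_growing : Un_growing sqrt_bound.
Proof. intros n. simpl. pose proof (sqrt_bound_range n). nra. Qed.

Lemma sqrt_iter_selfadj n : selfadj (sqrt_iter n).
Proof.
  induction n; [apply selfadj_zero|]. simpl. unfold selfadj. nc.
Qed.

Lemma sqrt_iter_comm z n : mul z k = mul k z -> mul z (sqrt_iter n) = mul (sqrt_iter n) z.
Proof.
  intros H. induction n; simpl; [nc|].
  transitivity (rsmul (/2) (add (mul z k) (mul (mul z (sqrt_iter n)) (sqrt_iter n)))); [nc|].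
  rewrite IHn, H.
  transitivity (rsmul (/2) (add (mul k z) (mul (sqrt_iter n) (mul z (sqrt_iter n))))); [nc|].
  rewrite IHn. nc.
Qed.

Lemma sqrt_iter_norm n : norm (sqrt_iter n) <= sqrt_bound n.
Proof.
  induction n; simpl; [rewrite norm_zero; lra|].
  rewrite norm_rsmul, Rabs_right by lra.
  pose proof (norm_triangle A k (mul (sqrt_iter n) (sqrt_iter n))).
  pose proof (norm_mul A (sqrt_iter n) (sqrt_iter n)).
  pose proof (norm_nonneg A (sqrt_iter n)). nra.
Qed.

(** All iterates are polynomials in k and commute, so the difference of consecutive squares factors
    as (difference)(sum), exactly as for the scalar majorant. *)
Lemma sqrt_iter_step n :
  norm (sub (sqrt_iter (S n)) (sqrt_iter n)) <= sqrt_bound (S n) - sqrt_bound n.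
Proof.
  induction n.
  - simpl. replace (sub _ _) with (rsmul (/2) k) by nc.
    rewrite norm_rsmul, Rabs_right by lra. lra.
  - change (sqrt_iter (S (S n)))
      with (rsmul (/2) (add k (mul (sqrt_iter (S n)) (sqrt_iter (S n))))).
    change (sqrt_bound (S (S n))) with ((1 + sqrt_bound (S n) * sqrt_bound (S n)) / 2).
    assert (E : sqrt_iter (S n) = rsmul (/2) (add k (mul (sqrt_iter n) (sqrt_iter n))))
      by reflexivity.
    replace (sub _ _) with (rsmul (/2)
      (sub (mul (sqrt_iter (S n)) (sqrt_iter (S n))) (mul (sqrt_iter n) (sqrt_iter n))))
      by nc_from (f_equal (rsmul 1) E).
    replace (sub (mul (sqrt_iter (S n)) (sqrt_iter (S n))) (mul (sqrt_iter n) (sqrt_iter n)))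
      with (mul (sub (sqrt_iter (S n)) (sqrt_iter n)) (add (sqrt_iter (S n)) (sqrt_iter n))).
    2: { assert (C : mul (sqrt_iter (S n)) (sqrt_iter n) = mul (sqrt_iter n) (sqrt_iter (S n))).
         { symmetry. apply sqrt_iter_comm. symmetry. now apply sqrt_iter_comm. }
         revert C. generalize (sqrt_iter (S n)) (sqrt_iter n). intros x y C.
         nc_from C. }
    rewrite norm_rsmul, Rabs_right by lra.
    pose proof (norm_mul A (sub (sqrt_iter (S n)) (sqrt_iter n))
      (add (sqrt_iter (S n)) (sqrt_iter n))).
    pose proof (norm_triangle A (sqrt_iter (S n)) (sqrt_iter n)).
    pose proof (sqrt_iter_norm (S n)). pose proof (sqrt_iter_norm n).
    pose proof (norm_nonneg A (sub (sqrt_iter (S n)) (sqrt_iter n))).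
    pose proof (norm_nonneg A (add (sqrt_iter (S n)) (sqrt_iter n))).
    pose proof (sqrt_bound_range n) as B.
    change (sqrt_bound (S n)) with ((1 + sqrt_bound n * sqrt_bound n) / 2) in *.
    nra.
Qed.

(* [s = 1 - y] where [y] is the limit of the iteration, the fixed point of
   [y = (k + y^2) / 2]. *)
Lemma one_minus_sqrt : exists s : A, selfadj s /\ norm (sub one s) <= 1 /\
  mul s s = sub one k /\ forall z, mul z k = mul k z -> mul z s = mul s z.
Proof.
  assert (HU : has_ub sqrt_bound).
  { exists 1. intros x [n ->]. apply sqrt_bound_range. }
  destruct (growing_cv _ sqrt_bound_growing HU) as [l Hl].
  assert (HD : forall n m, norm (sub (sqrt_iter (n + m)) (sqrt_iter n))
                             <= sqrt_bound (n + m) - sqrt_bound n).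
  { intros n m. induction m.
    - rewrite Nat.add_0_r. replace (sub _ _) with (@zero A) by nc. rewrite norm_zero; lra.
    - rewrite Nat.add_succ_r.
      pose proof (norm_sub_triangle (sqrt_iter (S (n + m))) (sqrt_iter (n + m)) (sqrt_iter n)).
      pose proof (sqrt_iter_step (n + m)). lra. }
  destruct (Un_cv_cvg_dominated _ _ _ Hl HD) as [y Hy].
  pose proof eventually_filter as EF.
  assert (Sy : selfadj y).
  { apply (cvg_unique EF sqrt_iter); auto.
    apply (cvg_ext EF) with (fun n => star (sqrt_iter n)).
    - intros n. apply sqrt_iter_selfadj.
    - now apply cvg_star. }
  assert (Fy : y = rsmul (/2) (add k (mul y y))).
  { apply (cvg_unique EF (fun n => sqrt_iter (S n))).
    - intros eps He. destruct (Hy eps He) as [N HN]. exists N. intros n Hn. apply HN. lia.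
    - simpl. apply cvg_smul; auto. apply cvg_add; auto.
      + now apply cvg_const.
      + now apply cvg_mul. }
  exists (sub one y). repeat split.
  - unfold selfadj. nc.
  - replace (sub one (sub one y)) with y by nc.
    apply (cvg_norm_le EF _ _ _ Hy). exists O. intros n _.
    pose proof (sqrt_iter_norm n). pose proof (sqrt_bound_range n). lra.
  - nc_from (f_equal (fun z => rsmul (-2) z) Fy).
  - intros z Hz.
    assert (C : mul z y = mul y z).
    { apply (cvg_unique EF (fun n => mul z (sqrt_iter n))).
      - apply cvg_mul; auto. now apply cvg_const.
      - apply (cvg_ext EF) with (fun n => mul (sqrt_iter n) z).
        + intros n. symmetry. now apply sqrt_iter_comm.
        + apply cvg_mul; auto. now apply cvg_const. }
    nc_from (f_equal (fun z => rsmul (-1) z) C).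
Qed.

End SqrtIteration.

(* Positivity expressed through the norm; it makes the positive elements a
   convex cone for free, and [psd_sqrt] and [psd_sq] identify them with squares. *)
Definition psd {A : CStarAlg} (h : A) : Prop :=
  selfadj h /\ exists t, norm (sub (rsmul t one) h) <= t.

Lemma psd_add {A : CStarAlg} (h k : A) : psd h -> psd k -> psd (add h k).
Proof.
  intros [Hh [t Ht]] [Hk [s Hs]]. split; [now apply selfadj_add|].
  exists (t + s).
  replace (sub _ _) with (add (sub (rsmul t one) h) (sub (rsmul s one) k)) by nc.
  pose proof (norm_triangle A (sub (rsmul t one) h) (sub (rsmul s one) k)). lra.
Qed.

Lemma psd_rsmul {A : CStarAlg} (r : R) (h : A) : 0 <= r -> psd h -> psd (rsmul r h).
Proof.
  intros Hr [Hh [t Ht]]. split; [now apply selfadj_rsmul|].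
  exists (r * t). replace (sub _ _) with (rsmul r (sub (rsmul t one) h)) by nc.
  rewrite norm_rsmul, Rabs_right by lra. nra.
Qed.

Lemma psd_norm_sub {A : CStarAlg} (t : R) (h : A) : selfadj h -> norm h <= t ->
  psd (sub (rsmul t one) h).
Proof.
  intros Hh Ht. pose proof (@selfadj_one A).
  split; [apply selfadj_sub; auto; now apply selfadj_rsmul|].
  exists t. now replace (sub _ _) with h by nc.
Qed.

(** With |t - h| <= t, the element k = 1 - h/t has norm at most 1 and h = t (1 - k), so the root is
    sqrt(t) times that of 1 - k. The commutation clause is what later lets several roots be treated
    as commuting. *)
Lemma psd_sqrt {A : CStarAlg} (h : A) : psd h -> exists s, psd s /\ mul s s = h /\
  forall z, mul z h = mul h z -> mul z s = mul s z.
Proof.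
  intros [Hh [t Ht]].
  pose proof (norm_nonneg A (sub (rsmul t one) h)) as T0.
  pose proof (@selfadj_one A) as S1.
  (* Division by [t] is impossible at t = 0, but there the norm bound forces h = 0. *)
  destruct (Req_dec t 0) as [E|E].
  - assert (h = zero) as ->.
    { subst t. rewrite norm_sub_sym in Ht. apply sub_eq0 in Ht. rewrite Ht. nc. }
    exists zero. split; [|split; intros; nc]. split; [apply selfadj_zero|].
    exists 0. replace (sub _ _) with (@zero A) by nc. rewrite norm_zero; lra.
  - assert (tpos : 0 < t) by lra.
    set (k := sub one (rsmul (/t) h)).
    assert (Sk : selfadj k) by (unfold k, selfadj; nc).
    assert (Nk : norm k <= 1).
    { replace k with (rsmul (/t) (sub (rsmul t one) h)) by (unfold k; nc).
      rewrite norm_rsmul, Rabs_right by (apply Rle_ge, Rlt_le, Rinv_0_lt_compat; lra).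
      apply Rmult_le_compat_l with (r := /t) in Ht; [|apply Rlt_le, Rinv_0_lt_compat; lra].
      rewrite Rinv_l in Ht; lra. }
    destruct (one_minus_sqrt k Sk Nk) as [s [Ss [Ns [Es Cs]]]].
    pose proof (sqrt_lt_R0 t tpos) as q0. pose proof (sqrt_sqrt t (Rlt_le _ _ tpos)) as qq.
    exists (rsmul (sqrt t) s). split; [|split].
    + split; [now apply selfadj_rsmul|]. exists (sqrt t).
      replace (sub _ _) with (rsmul (sqrt t) (sub one s)) by nc.
      rewrite norm_rsmul, Rabs_right by lra. nra.
    + replace (mul _ _) with (rsmul t (mul s s)).
      * rewrite Es. unfold k. nc.
      * rewrite <- qq at 1. nc.
    + intros z Hz. transitivity (rsmul (sqrt t) (mul z s)); [nc|].
      rewrite Cs; [nc|]. unfold k.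
      nc_from (f_equal (fun z => rsmul (-/t) z) Hz).
Qed.

(* [h + i c] is [t] times a unitary. *)
Lemma norm_le_circle {A : CStarAlg} (h c : A) (t : R) : 0 <= t -> selfadj h -> selfadj c ->
  mul h c = mul c h -> add (mul h h) (mul c c) = rsmul (t * t) one -> norm h <= t.
Proof.
  intros Ht Hh Hc C E. set (u := add h (smul Ci c)).
  assert (Eu : mul (star u) u = rsmul (t * t) one).
  { rewrite <- E. unfold u. nc_from (f_equal (fun z => smul Ci z) C). }
  assert (Nu : norm u <= t).
  { pose proof (norm_cstar A u) as N. rewrite Eu, norm_rsmul, Rabs_right in N by nra.
    pose proof (@norm_one_le A). pose proof (norm_nonneg A u).
    destruct (Rle_or_lt (norm u) t); auto. nra. }
  replace h with (rsmul (/2) (add u (star u))) by (unfold u; nc).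
  rewrite norm_rsmul, Rabs_right by lra.
  pose proof (norm_triangle A u (star u)). rewrite norm_star in H. lra.
Qed.

(** The root s of t^2 - a^2 commutes with a and satisfies s^2 + a^2 = t^2, so |s| <= t by
    [norm_le_circle]. Then |t^2 - a^2| = |s|^2 <= t^2, which is positivity of a^2. *)
Lemma psd_sq {A : CStarAlg} (a : A) : selfadj a -> psd (mul a a).
Proof.
  intros Ha. split; [unfold selfadj; nc|].
  pose proof (norm_nonneg A a) as N0. pose proof (@selfadj_one A) as S1.
  set (t := norm a + 1). exists (t * t).
  assert (Sa : selfadj (mul a a)) by (unfold selfadj; nc).
  assert (P : psd (sub (rsmul (t * t) one) (mul a a))).
  { apply psd_norm_sub; auto. rewrite norm_selfadj_sq by auto. unfold t; nra. }
  destruct (psd_sqrt _ P) as [s [[Ss _] [Es Cs]]].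
  rewrite <- Es, norm_selfadj_sq by auto.
  assert (norm s <= t).
  { apply norm_le_circle with a; auto; [unfold t; lra| |].
    - symmetry. apply Cs. nc.
    - nc_from Es. }
  pose proof (norm_nonneg A s). unfold t in *. nra.
Qed.

(** Commuting roots a of h and b of -h give (a + ib)* (a + ib) = a^2 + b^2 = 0, so a + ib vanishes,
    and so does its self-adjoint part a. *)
Lemma psd_anti {A : CStarAlg} (h : A) : psd h -> psd (opp h) -> h = zero.
Proof.
  intros H1 H2.
  destruct (psd_sqrt _ H1) as [a [[Sa _] [Ea Ca]]].
  destruct (psd_sqrt _ H2) as [b [[Sb _] [Eb Cb]]].
  assert (C : mul a b = mul b a).
  { apply Cb. symmetry. transitivity (rsmul (-1) (mul h a)); [nc|].
    rewrite <- Ea. nc. }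
  assert (E : norm (add a (smul Ci b)) * norm (add a (smul Ci b)) = 0).
  { rewrite <- norm_cstar.
    replace (mul _ _) with (@zero A); [apply norm_zero|].
    assert (D : smul Ci (mul a b) = smul Ci (mul b a)) by now rewrite C.
    assert (E : add (mul a a) (mul b b) = zero) by (rewrite Ea, Eb; nc).
    assert (G : add (smul Ci (mul a b)) (add (mul a a) (mul b b)) = add (smul Ci (mul b a)) zero)
      by now rewrite D, E.
    nc_from (eq_sym G). }
  assert (Z : add a (smul Ci b) = zero) by (apply norm_eq0; nra).
  assert (a = zero) as ->.
  { assert (G : add (add a (smul Ci b)) (star (add a (smul Ci b))) = add zero (star zero))
      by now rewrite Z.
    nc_from (f_equal (rsmul (/2)) G). }
  rewrite <- Ea. nc.
Qed.

(** With commuting roots a of t - h and b of t + h, (ab)^2 = t^2 - h^2, and [norm_le_circle] applies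
    to h and ab. *)
Lemma norm_le_of_psd {A : CStarAlg} (h : A) (t : R) : 0 <= t ->
  psd (sub (rsmul t one) h) -> psd (add (rsmul t one) h) -> norm h <= t.
Proof.
  intros Ht H1 H2. pose proof (@selfadj_one A) as S1.
  assert (Sh : selfadj h).
  { destruct H2 as [H2 _]. replace h with (sub (add (rsmul t one) h) (rsmul t one)) by nc.
    apply selfadj_sub; auto. now apply selfadj_rsmul. }
  destruct (psd_sqrt _ H1) as [a [[Sa _] [Ea Ca]]].
  destruct (psd_sqrt _ H2) as [b [[Sb _] [Eb Cb]]].
  assert (Cha : mul h a = mul a h) by (apply Ca; nc).
  assert (Chb : mul h b = mul b h) by (apply Cb; nc).
  assert (Cab : mul a b = mul b a).
  { apply Cb. nc_from (eq_sym Cha). }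
  apply norm_le_circle with (mul a b); auto.
  - now apply selfadj_mul_comm.
  - transitivity (mul (mul h a) b); [nc|]. rewrite Cha.
    transitivity (mul a (mul h b)); [nc|]. rewrite Chb. nc.
  - transitivity (add (mul h h) (mul a (mul (mul b a) b))); [nc|]. rewrite <- Cab.
    transitivity (add (mul h h) (mul (mul a a) (mul b b))); [nc|]. rewrite Ea, Eb. nc.
Qed.

(** * Positivity of [x* x] *)

Fixpoint npow {A : CStarAlg} (x : A) (n : nat) : A :=
  match n with O => one | S n => mul (npow x n) x end.

Lemma npow_add {A : CStarAlg} (x : A) (m n : nat) :
  npow x (m + n) = mul (npow x m) (npow x n).
Proof.
  induction n; simpl; [rewrite Nat.add_0_r; nc|].
  rewrite Nat.add_succ_r; simpl. rewrite IHn. nc.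
Qed.

Lemma npow_comm {A : CStarAlg} (x : A) (n : nat) : mul (npow x n) x = mul x (npow x n).
Proof.
  induction n; simpl; [nc|]. rewrite IHn at 1. nc.
Qed.

Lemma npow_selfadj {A : CStarAlg} (x : A) (n : nat) : selfadj x -> selfadj (npow x n).
Proof.
  intros Hx. induction n; simpl; [apply selfadj_one|].
  apply selfadj_mul_comm; auto. apply npow_comm.
Qed.

(** Squaring is the only power whose norm the C*-identity gives exactly; iterating it replaces the
    spectral radius formula. *)
Lemma norm_npow_two {A : CStarAlg} (x : A) (n : nat) : selfadj x -> (0 < n)%nat ->
  norm (npow x (2 ^ n)) = norm x ^ (2 ^ n).
Proof.
  intros Hx Hn. destruct n as [|n]; [lia|]. clear Hn. induction n.
  - simpl. replace (mul (mul one x) x) with (mul x x) by nc.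
    rewrite norm_selfadj_sq by auto. ring.
  - replace (2 ^ S (S n))%nat with (2 ^ S n + 2 ^ S n)%nat by (simpl; lia).
    rewrite npow_add, norm_selfadj_sq, pow_add by now apply npow_selfadj.
    now rewrite IHn.
Qed.

Lemma le_of_pow_two_bound (x t C : R) : 0 < t -> 0 <= C ->
  (forall n, (0 < n)%nat -> t * x ^ (2 ^ n) <= t ^ (2 ^ n) * (t + INR (2 ^ n) * C)) -> x <= t.
Proof.
  intros Ht HC H. apply Rnot_lt_le. intros Hx.
  set (d := x / t - 1).
  assert (Hxd : x = t * (1 + d)) by (unfold d; field; lra).
  assert (Hd : 0 < d) by (nra).
  assert (B : forall n, INR (2 ^ n) * INR (2 ^ n) * (d * d) * t <= t + 2 * INR (2 ^ n) * C).
  { intros n. specialize (H (S n) ltac:(lia)). rewrite Hxd, Rpow_mult_distr in H.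
    assert (0 < t ^ (2 ^ S n)) by now apply pow_lt.
    assert (H' : t * (1 + d) ^ (2 ^ S n) <= t + INR (2 ^ S n) * C).
    { apply Rmult_le_reg_l with (t ^ (2 ^ S n)); [auto|]. lra. }
    replace (2 ^ S n)%nat with (2 ^ n + 2 ^ n)%nat in H' by (simpl; lia).
    rewrite pow_add, plus_INR in H'.
    pose proof (poly (2 ^ n) d Hd) as P.
    assert (0 <= INR (2 ^ n)) by apply pos_INR.
    assert (INR (2 ^ n) * d * (INR (2 ^ n) * d) <= (1 + d) ^ (2 ^ n) * (1 + d) ^ (2 ^ n))
      by (apply Rmult_le_compat; nra).
    nra. }
  (* For N = 2^n beyond this threshold, N d^2 t > t + 2C; multiplying by N >= 1 contradicts [B]. *)
  set (M := (t + 2 * C) / (d * d * t)).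
  assert (dt : 0 < d * d * t) by (apply Rmult_lt_0_compat; nra).
  destruct (INR_unbounded M) as [n Hn].
  assert (G : INR n <= INR (2 ^ n)) by (apply le_INR, Nat.lt_le_incl, Nat.pow_gt_lin_r; lia).
  assert (O : 1 <= INR (2 ^ n)).
  { apply (le_INR 1). pose proof (Nat.pow_nonzero 2 n). lia. }
  specialize (B n).
  assert (K : t + 2 * C < INR (2 ^ n) * (d * d * t)).
  { apply Rlt_le_trans with (INR n * (d * d * t)); [|apply Rmult_le_compat_r; lra].
    apply Rmult_lt_compat_r with (r := d * d * t) in Hn; auto.
    unfold M in Hn. replace ((t + 2 * C) / (d * d * t) * (d * d * t)) with (t + 2 * C) in Hn
      by (field; lra). lra. }
  nra.
Qed.

(* [q^(n+1) = t q^n + y p^n y*] for [p = t + y* y], [q = t + y y*], so the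
   powers of [q] exceed those of [t] at most by a linear factor. *)
Lemma norm_flip {A : CStarAlg} (y : A) (t : R) : 0 < t ->
  norm (add (rsmul t one) (mul (star y) y)) <= t ->
  norm (add (rsmul t one) (mul y (star y))) <= t.
Proof.
  intros Ht. set (p := add _ _). set (q := add _ _). intros Hp.
  assert (Sq : selfadj q) by (unfold q, selfadj; nc).
  assert (I : forall n, mul y (npow p n) = mul (npow q n) y).
  { induction n; simpl; [nc|].
    transitivity (mul (mul y (npow p n)) p); [nc|]. rewrite IHn. unfold p, q; nc. }
  assert (Np : forall n, norm (npow p n) <= t ^ n).
  { induction n; simpl; [apply norm_one_le|].
    pose proof (norm_mul A (npow p n) p). pose proof (norm_nonneg A p).
    pose proof (norm_nonneg A (npow p n)). pose proof (pow_lt t n Ht). nra. }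
  assert (Nq : forall n, t * norm (npow q n) <= t ^ n * (t + INR n * (norm y * norm y))).
  { induction n.
    - simpl. pose proof (@norm_one_le A). nra.
    - assert (E : npow q (S n) = add (rsmul t (npow q n)) (mul (mul y (npow p n)) (star y))).
      { rewrite I. simpl. unfold q at 2. nc. }
      rewrite E, S_INR. simpl pow.
      pose proof (norm_triangle A (rsmul t (npow q n)) (mul (mul y (npow p n)) (star y))) as N1.
      rewrite norm_rsmul, Rabs_right in N1 by lra.
      pose proof (norm_mul A (mul y (npow p n)) (star y)) as N2. rewrite norm_star in N2.
      pose proof (norm_mul A y (npow p n)) as N3. specialize (Np n).
      pose proof (norm_nonneg A y). pose proof (norm_nonneg A (npow p n)).
      assert (norm (mul (mul y (npow p n)) (star y)) <= norm y * norm y * t ^ n).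
      { eapply Rle_trans; [apply N2|].
        replace (norm y * norm y * t ^ n) with (norm y * t ^ n * norm y) by ring.
        apply Rmult_le_compat_r; auto. eapply Rle_trans; [apply N3|].
        now apply Rmult_le_compat_l. }
      nra. }
  apply le_of_pow_two_bound with (norm y * norm y); auto.
  - pose proof (norm_nonneg A y). nra.
  - intros n Hn. rewrite <- norm_npow_two by auto. apply Nq.
Qed.

(** Takes the place of the fact that y* y and y y* have the same non-zero spectrum. *)
Lemma psd_opp_flip {A : CStarAlg} (y : A) :
  psd (opp (mul (star y) y)) -> psd (opp (mul y (star y))).
Proof.
  (* The shift by 1 makes the constant positive, as [norm_flip] requires; [t] itself may be 0. *)
  intros [_ [t Ht]]. split; [unfold selfadj; nc|]. exists (t + 1).
  pose proof (norm_nonneg A (sub (rsmul t one) (opp (mul (star y) y)))).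
  replace (sub _ _) with (add (rsmul (t + 1) one) (mul y (star y))) by nc.
  apply norm_flip; [lra|].
  replace (add _ _) with (add one (sub (rsmul t one) (opp (mul (star y) y)))) by nc.
  pose proof (norm_triangle A one (sub (rsmul t one) (opp (mul (star y) y)))).
  pose proof (@norm_one_le A). lra.
Qed.

(** For y = a + ib one has y* y + y y* = 2 a^2 + 2 b^2. Since -y y* is positive as well, y* y is a
    sum of positive elements, hence positive and negative at once. *)
Lemma star_mul_psd_opp_zero {A : CStarAlg} (y : A) :
  psd (opp (mul (star y) y)) -> y = zero.
Proof.
  intros H. pose proof (psd_opp_flip y H) as H'.
  set (a := rsmul (/2) (add y (star y))).
  set (b := smul (mkC 0 (-/2)) (sub y (star y))).
  assert (Sa : selfadj a) by (unfold a, selfadj; nc).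
  assert (Sb : selfadj b) by (unfold b, selfadj; nc).
  assert (P : psd (mul (star y) y)).
  { replace (mul (star y) y)
      with (add (add (rsmul 2 (mul a a)) (rsmul 2 (mul b b))) (opp (mul y (star y))))
      by (unfold a, b; nc).
    apply psd_add; auto. apply psd_add; apply psd_rsmul; try lra; now apply psd_sq. }
  pose proof (psd_anti _ P H) as E.
  apply norm_eq0. pose proof (norm_cstar A y) as N. rewrite E, norm_zero in N.
  pose proof (norm_nonneg A y). nra.
Qed.

(* With [h = x* x], [m = |h|] and [p = m - h], the element [y = x p] satisfies
   [y* y = p h p = - p m p], hence vanishes, which forces [p = 0]. *)
Lemma psd_star_mul {A : CStarAlg} (x : A) : psd (mul (star x) x).
Proof.
  set (h := mul (star x) x).
  assert (Sh : selfadj h) by apply selfadj_star_mul.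
  destruct (psd_sqrt _ (psd_sq h Sh)) as [m [Pm [Em Cm]]].
  (* A further root, of m itself: it exhibits p m p as the square of the self-adjoint p r. *)
  destruct (psd_sqrt _ Pm) as [r [[Sr _] [Er Cr]]].
  assert (Sm : selfadj m) by apply Pm.
  assert (Chm : mul h m = mul m h) by (apply Cm; nc).
  assert (Chr : mul h r = mul r h) by now apply Cr.
  assert (Cmr : mul m r = mul r m) by (apply Cr; nc).
  set (p := sub m h).
  assert (Sp : selfadj p) by (unfold p; now apply selfadj_sub).
  assert (Cpr : mul p r = mul r p).
  { unfold p. transitivity (sub (mul m r) (mul h r)); [nc|]. rewrite Chr, Cmr. nc. }
  assert (Spr : selfadj (mul p r)) by now apply selfadj_mul_comm.
  assert (Cpm : mul p m = mul m p) by (unfold p; nc_from (f_equal (rsmul (-1)) Chm)).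
  assert (Ehp : mul h p = rsmul (-1) (mul m p)).
  { unfold p. transitivity (sub (mul h m) (mul h h)); [nc|]. rewrite Chm, <- Em. nc. }
  assert (Emp : mul (mul p r) (mul p r) = mul p (mul m p)).
  { transitivity (mul p (mul r (mul p r))); [nc|]. rewrite Cpr.
    transitivity (mul p (mul (mul r r) p)); [nc|]. now rewrite Er. }
  assert (Y : mul x p = zero).
  { apply star_mul_psd_opp_zero.
    replace (opp _) with (mul (mul p r) (mul p r)); [now apply psd_sq|].
    rewrite Emp. transitivity (opp (mul p (mul h p))); [rewrite Ehp; nc|].
    unfold h at 1. nc. }
  assert (Z : mul h p = zero).
  { unfold h. transitivity (mul (star x) (mul x p)); [nc|]. rewrite Y. nc. }
  (* From h p = 0 follows m p = -h p = 0, hence p^2 = m p - h p = 0. *)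
  assert (p = zero).
  { apply selfadj_sq_zero; auto. unfold p at 1.
    transitivity (sub (mul m p) (mul h p)); [nc|]. rewrite Z.
    nc_from (f_equal (rsmul (-1)) (eq_trans (eq_sym Ehp) Z)). }
  replace h with m; auto. apply sub_eq0. fold p. rewrite H, norm_zero. lra.
Qed.

(** * Zorn's lemma and the Hahn-Banach theorem *)

Lemma zorn_preorder (T : Type) (t0 : T) (le : T -> T -> Prop) :
  (forall t, le t t) -> (forall r s t, le r s -> le s t -> le r t) ->
  (forall C : T -> Prop, (forall s t, C s -> C t -> le s t \/ le t s) ->
     exists t, forall s, C s -> le s t) ->
  exists m, forall s, le m s -> le s m.
Proof.
  intros Hr Ht Hc.
  destruct (@classical_sets.ZL_preorder T t0 (fun s t => boolp.asbool (le s t))) as [m Hm].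
  - intros t. now apply boolp.asboolT.
  - intros r s t H1 H2. apply boolp.asboolT.
    apply Ht with s; now apply boolp.asboolW.
  - intros C HC. destruct (Hc C) as [t Htt].
    + intros s t Hs Htt. destruct (HC s t Hs Htt); [left|right]; now apply boolp.asboolW.
    + exists t. intros s Hs. apply boolp.asboolT; auto.
  - exists m. intros s Hs. apply boolp.asboolW, Hm. now apply boolp.asboolT.
Qed.

Definition is_glb (E : R -> Prop) (m : R) : Prop :=
  (forall x, E x -> m <= x) /\ forall y, (forall x, E x -> y <= x) -> y <= m.

(* Unspecified unless [E] is nonempty and bounded below. *)
Definition Rinf (E : R -> Prop) : R := epsilon (inhabits 0) (is_glb E).

Lemma Rinf_glb (E : R -> Prop) (b : R) : (exists x, E x) -> (forall x, E x -> b <= x) ->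
  is_glb E (Rinf E).
Proof.
  intros [x Hx] Hb. unfold Rinf. apply epsilon_spec.
  destruct (completeness (fun y => E (- y))) as [m [H1 H2]].
  - exists (- b). intros y Hy. specialize (Hb _ Hy). lra.
  - exists (- x). now rewrite Ropp_involutive.
  - exists (- m). split.
    + intros y Hy. assert (- y <= m) by (apply H1; now rewrite Ropp_involutive). lra.
    + intros y Hy. assert (m <= - y); [|lra].
      apply H2. intros z Hz. specialize (Hy _ Hz). lra.
Qed.

(** An inequality suffices for homogeneity, since applying it to 1/r gives the converse; it is
    easier to check for infima. *)
Definition sublinear {A : CStarAlg} (q : A -> R) : Prop :=
  (forall x y, q (add x y) <= q x + q y) /\ (forall r x, 0 < r -> q (rsmul r x) <= r * q x).

Lemma sublinear_zero {A : CStarAlg} (q : A -> R) : sublinear q -> q zero = 0.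
Proof.
  intros [_ H]. pose proof (H 2 zero ltac:(lra)) as H1. pose proof (H (/2) zero ltac:(lra)) as H2.
  replace (rsmul 2 (@zero A)) with (@zero A) in H1 by nc.
  replace (rsmul (/2) (@zero A)) with (@zero A) in H2 by nc. lra.
Qed.

Lemma sublinear_opp {A : CStarAlg} (q : A -> R) (x : A) : sublinear q -> - q (opp x) <= q x.
Proof.
  intros H. pose proof (sublinear_zero q H). destruct H as [H _]. specialize (H x (opp x)).
  rewrite add_opp in H. lra.
Qed.

(** The functional is y |-> inf over t >= 0 of q(y + t b) - t q(b). The value t = 0 gives q' <= q,
    and t = 1 at y = -b gives the last bound. *)
Lemma sublinear_sharpen {A : CStarAlg} (q : A -> R) (b : A) : sublinear q ->
  exists q', sublinear q' /\ (forall x, q' x <= q x) /\ q' (opp b) <= - q b.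
Proof.
  intros Hq.
  set (E := fun y v => exists t, 0 <= t /\ v = q (add y (rsmul t b)) - t * q b).
  assert (G : forall y, is_glb (E y) (Rinf (E y))).
  { intros y. apply Rinf_glb with (- q (opp y)).
    - exists (q (add y (rsmul 0 b)) - 0 * q b). exists 0. split; [lra|reflexivity].
    - intros v [t [Ht ->]]. destruct (Req_dec t 0) as [->|].
      + replace (add y (rsmul 0 b)) with y by nc. pose proof (sublinear_opp q y Hq). lra.
      + destruct Hq as [Ha Hm]. pose proof (Ha (add y (rsmul t b)) (opp y)) as H1.
        replace (add (add y (rsmul t b)) (opp y)) with (rsmul t b) in H1 by nc.
        pose proof (Hm (/t) (rsmul t b) ltac:(apply Rinv_0_lt_compat; lra)) as H2.
        replace (rsmul (/t) (rsmul t b)) with b in H2 by nc.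
        apply Rmult_le_compat_l with (r := t) in H2; [|lra].
        rewrite <- Rmult_assoc, Rinv_r in H2 by lra. lra. }
  exists (fun y => Rinf (E y)). split; [split|split].
  - intros x y.
    assert (K : Rinf (E (add x y)) - Rinf (E y) <= Rinf (E x)); [|lra].
    apply (proj2 (G x)). intros v [t [Ht ->]].
    assert (K : Rinf (E (add x y)) - (q (add x (rsmul t b)) - t * q b) <= Rinf (E y)); [|lra].
    apply (proj2 (G y)). intros w [s [Hs ->]].
    assert (Rinf (E (add x y)) <= q (add (add x y) (rsmul (t + s) b)) - (t + s) * q b).
    { apply (proj1 (G _)). exists (t + s). split; [lra|reflexivity]. }
    pose proof (proj1 Hq (add x (rsmul t b)) (add y (rsmul s b))) as H1.
    replace (add (add x (rsmul t b)) (add y (rsmul s b)))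
      with (add (add x y) (rsmul (t + s) b)) in H1 by nc. lra.
  - intros r x Hr.
    assert (K : Rinf (E (rsmul r x)) / r <= Rinf (E x)).
    { apply (proj2 (G x)). intros v [t [Ht ->]].
      apply Rmult_le_reg_l with r; auto.
      replace (r * (Rinf (E (rsmul r x)) / r)) with (Rinf (E (rsmul r x))) by (field; lra).
      apply Rle_trans with (q (add (rsmul r x) (rsmul (r * t) b)) - (r * t) * q b).
      - apply (proj1 (G _)). exists (r * t). split; [nra|reflexivity].
      - replace (add (rsmul r x) (rsmul (r * t) b)) with (rsmul r (add x (rsmul t b))) by nc.
        pose proof (proj2 Hq r (add x (rsmul t b)) Hr). lra. }
    apply Rmult_le_compat_l with (r := r) in K; [|lra].
    replace (r * (Rinf (E (rsmul r x)) / r)) with (Rinf (E (rsmul r x))) in K by (field; lra).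
    exact K.
  - intros x. apply (proj1 (G x)). exists 0. split; [lra|].
    replace (add x (rsmul 0 b)) with x by nc. ring.
  - apply (proj1 (G _)). exists 1. split; [lra|].
    replace (add (opp b) (rsmul 1 b)) with (@zero A) by nc.
    rewrite (sublinear_zero q Hq). ring.
Qed.

(** Zorn's lemma for the reversed pointwise order; the bound of a chain is its pointwise infimum. *)
Lemma sublinear_minimal {A : CStarAlg} (p : A -> R) : sublinear p ->
  exists q, sublinear q /\ (forall x, q x <= p x) /\
    forall q', sublinear q' -> (forall x, q' x <= q x) -> forall x, q x <= q' x.
Proof.
  intros Hp. set (T := {q : A -> R | sublinear q /\ forall x, q x <= p x}).
  assert (p0 : T) by (exists p; split; auto; intros; lra).
  destruct (zorn_preorder T p0 (fun q q' => forall x, proj1_sig q' x <= proj1_sig q x))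
    as [[q [Hq Hqp]] Hmin].
  - intros; lra.
  - intros q1 q2 q3 H1 H2 x. specialize (H1 x). specialize (H2 x). lra.
  - intros C HC. destruct (classic (exists q, C q)) as [[q1 Hq1]|N].
    (* The empty chain has no pointwise infimum and is bounded by [p] itself. *)
    2: { exists p0. intros s Hs. exfalso. apply N. now exists s. }
    set (E := fun x v => exists q, C q /\ v = proj1_sig q x).
    assert (G : forall x, is_glb (E x) (Rinf (E x))).
    { intros x. apply Rinf_glb with (- p (opp x)).
      - exists (proj1_sig q1 x). now exists q1.
      - intros v [[q [Hq Hqp]] [_ ->]]. simpl.
        pose proof (sublinear_opp q x Hq). specialize (Hqp (opp x)). lra. }
    assert (S : sublinear (fun x => Rinf (E x)) /\ forall x, Rinf (E x) <= p x).
    { split; [split|].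
      - intros x y.
        assert (K : Rinf (E (add x y)) - Rinf (E y) <= Rinf (E x)); [|lra].
        apply (proj2 (G x)). intros v [q [Cq ->]].
        assert (K : Rinf (E (add x y)) - proj1_sig q x <= Rinf (E y)); [|lra].
        apply (proj2 (G y)). intros w [r [Cr ->]].
        assert (Hb : forall s, C s -> Rinf (E (add x y)) <= proj1_sig s x + proj1_sig s y).
        { intros s Cs. apply Rle_trans with (proj1_sig s (add x y)).
          - apply (proj1 (G _)). now exists s.
          - apply (proj2_sig s). }
        (* Subadditivity of the infimum rests on comparability: the smaller of [q] and [r] serves
           for both summands. *)
        destruct (HC q r Cq Cr) as [L|L].
        + pose proof (Hb r Cr). specialize (L x). lra.
        + pose proof (Hb q Cq). specialize (L y). lra.
      - intros r x Hr.
        assert (K : Rinf (E (rsmul r x)) / r <= Rinf (E x)).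
        { apply (proj2 (G x)). intros v [q [Cq ->]].
          apply Rmult_le_reg_l with r; auto.
          replace (r * (Rinf (E (rsmul r x)) / r)) with (Rinf (E (rsmul r x))) by (field; lra).
          apply Rle_trans with (proj1_sig q (rsmul r x)).
          - apply (proj1 (G _)). now exists q.
          - now apply (proj2_sig q). }
        apply Rmult_le_compat_l with (r := r) in K; [|lra].
        replace (r * (Rinf (E (rsmul r x)) / r)) with (Rinf (E (rsmul r x))) in K
          by (field; lra).
        exact K.
      - intros x. apply Rle_trans with (proj1_sig q1 x).
        + apply (proj1 (G x)). now exists q1.
        + apply (proj2_sig q1). }
    exists (exist (fun q => sublinear q /\ forall x, q x <= p x) (fun x => Rinf (E x)) S).
    intros s Cs x. simpl. apply (proj1 (G x)). now exists s.
  - exists q. split; [auto|split; [auto|]]. intros q' Hq' L.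
    assert (L' : forall x, q' x <= p x) by (intros x; eapply Rle_trans; eauto).
    exact (Hmin (exist (fun q => sublinear q /\ forall x, q x <= p x) q' (conj Hq' L')) L).
Qed.

(* A minimal sublinear functional is linear, since it cannot be sharpened. *)
Lemma hahn_banach {A : CStarAlg} (p : A -> R) (b : A) : sublinear p ->
  exists q : A -> R, (forall x y, q (add x y) = q x + q y) /\
    (forall r x, q (rsmul r x) = r * q x) /\ (forall x, q x <= p x) /\ q b = p b.
Proof.
  (* Sharpening at [b] beforehand pins the value there: every q below p1 has q(-b) <= -p(b), so a
     linear one has q(b) >= p(b). *)
  intros Hp. destruct (sublinear_sharpen p b Hp) as [p1 [Hp1 [L1 B1]]].
  destruct (sublinear_minimal p1 Hp1) as [q [Hq [Lq Mq]]].
  assert (Ho : forall x, q (opp x) = - q x).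
  { intros x. destruct (sublinear_sharpen q x Hq) as [q' [Hq' [L' B']]].
    specialize (Mq q' Hq' L' (opp x)). pose proof (sublinear_opp q x Hq). lra. }
  assert (Hpos : forall r x, 0 < r -> q (rsmul r x) = r * q x).
  { intros r x Hr. apply Rle_antisym; [now apply Hq|].
    pose proof (proj2 Hq (/r) (rsmul r x) (Rinv_0_lt_compat r Hr)) as H.
    replace (rsmul (/r) (rsmul r x)) with x in H by nc.
    apply Rmult_le_compat_l with (r := r) in H; [|lra].
    rewrite <- Rmult_assoc, Rinv_r in H by lra. lra. }
  exists q. repeat split.
  - intros x y. apply Rle_antisym; [apply Hq|].
    pose proof (proj1 Hq (add x y) (opp y)) as H. rewrite Ho in H.
    replace (add (add x y) (opp y)) with x in H by nc. lra.
  - intros r x. destruct (Rtotal_order r 0) as [Hr|[->|Hr]]; [| |now apply Hpos].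
    + replace (rsmul r x) with (opp (rsmul (- r) x)) by nc.
      rewrite Ho, Hpos by lra. ring.
    + replace (rsmul 0 x) with (@zero A) by nc. rewrite (sublinear_zero q Hq). ring.
  - intros x. specialize (L1 x). specialize (Lq x). lra.
  - pose proof (Lq (opp b)) as H. rewrite Ho in H. specialize (L1 b). specialize (Lq b). lra.
Qed.

(** * States *)

Definition re_part {A : CStarAlg} (x : A) : A := rsmul (/2) (add x (star x)).
Definition im_part {A : CStarAlg} (x : A) : A := smul (mkC 0 (-/2)) (sub x (star x)).

Lemma re_part_selfadj {A : CStarAlg} (x : A) : selfadj (re_part x).
Proof. unfold selfadj, re_part; nc. Qed.
Lemma im_part_selfadj {A : CStarAlg} (x : A) : selfadj (im_part x).
Proof. unfold selfadj, im_part; nc. Qed.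
Lemma re_im_part {A : CStarAlg} (x : A) : x = add (re_part x) (smul Ci (im_part x)).
Proof. unfold re_part, im_part; nc. Qed.

Definition order_le {A : CStarAlg} (x : A) (t : R) : Prop :=
  psd (sub (rsmul t one) (re_part x)).

(** Let h be the real part of x. If t < -|h|, the positive elements t - h and |h| + h add up to a
    negative multiple of 1, so 1 and -1 are both positive and 1 = 0. In the zero algebra every t is
    an upper bound and the infimum below is meaningless. *)
Lemma order_le_lower {A : CStarAlg} (x : A) (t : R) : @one A <> zero ->
  order_le x t -> - norm (re_part x) <= t.
Proof.
  intros N H. apply Rnot_lt_le. intros L. apply N.
  pose proof (re_part_selfadj x) as Sx. set (h := re_part x) in *.
  pose proof (@selfadj_one A) as S1.
  assert (H1 : psd (sub (rsmul (norm h) one) (rsmul (-1) h))).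
  { apply psd_norm_sub; [now apply selfadj_rsmul|].
    rewrite norm_rsmul, Rabs_left by lra. lra. }
  pose proof (psd_add _ _ H H1) as H2.
  set (s := - (norm h + t)). assert (Hs : 0 < s) by (unfold s; lra).
  replace (add _ _) with (rsmul (- s) (@one A)) in H2 by (unfold s; fold h; nc).
  apply psd_anti; [replace one with (mul (@one A) one) by nc; now apply psd_sq|].
  apply psd_rsmul with (r := / s) in H2; [|apply Rlt_le, Rinv_0_lt_compat; lra].
  replace (rsmul (/ s) (rsmul (- s) one)) with (@opp A one) in H2 by nc. exact H2.
Qed.

Lemma order_le_norm {A : CStarAlg} (x : A) : order_le x (norm (re_part x)).
Proof. apply psd_norm_sub; [apply re_part_selfadj|lra]. Qed.

(** The top of the spectrum of the real part of x, expressed through the order. *)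
Definition order_sup {A : CStarAlg} (x : A) : R := Rinf (order_le x).

Lemma order_sup_glb {A : CStarAlg} (x : A) : @one A <> zero ->
  is_glb (order_le x) (order_sup x).
Proof.
  intros N. apply Rinf_glb with (- norm (re_part x)).
  - exists (norm (re_part x)). apply order_le_norm.
  - intros t Ht. now apply order_le_lower.
Qed.

Lemma order_sup_sublinear {A : CStarAlg} : @one A <> zero -> sublinear (@order_sup A).
Proof.
  intros N. pose proof (fun x => order_sup_glb x N) as G. split.
  - intros x y.
    assert (K : order_sup (add x y) - order_sup y <= order_sup x); [|lra].
    apply (proj2 (G x)). intros t Ht.
    assert (K : order_sup (add x y) - t <= order_sup y); [|lra].
    apply (proj2 (G y)). intros s Hs.
    assert (order_sup (add x y) <= t + s); [|lra].
    apply (proj1 (G _)). unfold order_le.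
    replace (sub _ _) with (add (sub (rsmul t one) (re_part x)) (sub (rsmul s one) (re_part y)))
      by (unfold re_part; nc).
    now apply psd_add.
  - intros r x Hr.
    assert (K : order_sup (rsmul r x) / r <= order_sup x).
    { apply (proj2 (G x)). intros t Ht.
      apply Rmult_le_reg_l with r; auto.
      replace (r * (order_sup (rsmul r x) / r)) with (order_sup (rsmul r x)) by (field; lra).
      apply (proj1 (G _)). unfold order_le.
      replace (sub _ _) with (rsmul r (sub (rsmul t one) (re_part x))) by (unfold re_part; nc).
      apply psd_rsmul; [lra|auto]. }
    apply Rmult_le_compat_l with (r := r) in K; [|lra].
    replace (r * (order_sup (rsmul r x) / r)) with (order_sup (rsmul r x)) in K by (field; lra).
    exact K.
Qed.

(** A real-linear q below [order_sup] is positive, because [order_sup] of -h is at most 0 for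
    positive h, and it is 1 at the unit by testing 1 and -1. The state is its complexification q(Re
    x) + i q(Im x). *)
Lemma state_attaining_order_sup {A : CStarAlg} (b : A) : @one A <> zero -> selfadj b ->
  exists phi, is_state phi /\ re (phi b) = order_sup b.
Proof.
  intros N Sb. pose proof (fun x => order_sup_glb x N) as G.
  destruct (hahn_banach _ b (order_sup_sublinear N)) as [q [qa [qm [ql qb]]]].
  pose proof (@selfadj_one A) as S1.
  assert (qneg : forall h, psd h -> 0 <= q h).
  { intros h Hh. assert (q (rsmul (-1) h) <= 0).
    { eapply Rle_trans; [apply ql|]. apply (proj1 (G _)). unfold order_le.
      destruct Hh as [Sh Hh']. replace (sub _ _) with h by (unfold re_part; nc).
      now split. }
    rewrite qm in H. lra. }
  assert (q1 : q one = 1).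
  { apply Rle_antisym.
    - eapply Rle_trans; [apply ql|]. apply (proj1 (G _)). unfold order_le.
      replace (sub _ _) with (mul (@zero A) zero) by (unfold re_part; nc).
      apply psd_sq, selfadj_zero.
    - assert (H : q (rsmul (-1) one) <= -1).
      { eapply Rle_trans; [apply ql|]. apply (proj1 (G _)). unfold order_le.
        replace (sub _ _) with (mul (@zero A) zero) by (unfold re_part; nc).
        apply psd_sq, selfadj_zero. }
      rewrite qm in H. lra. }
  assert (q0 : q zero = 0).
  { replace (@zero A) with (rsmul 0 (@zero A)) by nc. rewrite qm. ring. }
  exists (fun x => mkC (q (re_part x)) (q (im_part x))). split; [split; [|split; [|split]]|].
  - intros x y. apply Cplx_ext; simpl; rewrite <- qa; f_equal; unfold re_part, im_part; nc.
  - intros c x. apply Cplx_ext; simpl.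
    + replace (re_part (smul c x))
        with (add (rsmul (re c) (re_part x)) (rsmul (- im c) (im_part x)))
        by (unfold re_part, im_part; nc).
      rewrite qa, !qm. ring.
    + replace (im_part (smul c x))
        with (add (rsmul (re c) (im_part x)) (rsmul (im c) (re_part x)))
        by (unfold re_part, im_part; nc).
      rewrite qa, !qm. ring.
  - intros x. simpl. split.
    + replace (im_part _) with (@zero A) by (unfold im_part; nc). exact q0.
    + apply qneg. replace (re_part _) with (mul (star x) x) by (unfold re_part; nc).
      apply psd_star_mul.
  - apply Cplx_ext; simpl.
    + replace (re_part one) with (@one A) by (unfold re_part; nc). exact q1.
    + replace (im_part one) with (@zero A) by (unfold im_part; nc). exact q0.
  - simpl. rewrite <- qb. f_equal. unfold re_part; nc.
Qed.

Lemma re_le_Cabs (z : Cplx) : re z <= Cabs z.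
Proof.
  unfold Cabs. eapply Rle_trans; [apply Rle_abs|]. rewrite <- sqrt_Rsqr_abs.
  apply sqrt_le_1_alt. unfold Rsqr. nra.
Qed.

Lemma norm_le_states {A : CStarAlg} (b : A) (c : R) : selfadj b -> 0 <= c ->
  (forall phi : A -> Cplx, is_state phi -> Cabs (phi b) <= c) -> norm b <= c.
Proof.
  (* The zero algebra has no states, so the hypothesis on states is vacuous there and the norm is
     computed directly. *)
  intros Sb Hc H. destruct (classic (@one A = zero)) as [E|N].
  { replace b with (@zero A); [rewrite norm_zero; lra|].
    transitivity (mul b one); [rewrite E|]; nc. }
  assert (K : forall (a : A) t, selfadj a ->
     (forall phi : A -> Cplx, is_state phi -> re (phi a) <= c) -> c < t -> psd (sub (rsmul t one) a)).
  { intros a t Sa Ha Ht.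
    destruct (state_attaining_order_sup a N Sa) as [phi [Hphi E]].
    specialize (Ha phi Hphi). rewrite E in Ha.
    assert (Hex : exists s, s < t /\ order_le a s).
    { apply NNPP. intros Hn. assert (t <= order_sup a); [|lra].
      apply (order_sup_glb a N). intros s Hs. apply Rnot_lt_le. intros L. apply Hn. now exists s. }
    destruct Hex as [s [Hs Hle]]. unfold order_le in Hle.
    pose proof (@selfadj_one A) as S1.
    replace (sub _ _) with (add (sub (rsmul s one) (re_part a)) (rsmul (t - s) (mul one one)))
      by (unfold re_part; nc).
    apply psd_add; auto. apply psd_rsmul; [lra|]. now apply psd_sq. }
  (* [K] needs room above c, since [order_sup] is an infimum; the midpoint leaves it while staying
     below the supposed norm. *)
  apply Rnot_lt_le. intros L. set (t := (c + norm b) / 2).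
  assert (norm b <= t); [|unfold t in *; lra].
  apply norm_le_of_psd; [unfold t; lra| |].
  - apply K; auto; [|unfold t; lra].
    intros phi Hphi. specialize (H phi Hphi). pose proof (re_le_Cabs (phi b)). lra.
  - replace (add _ _) with (sub (rsmul t one) (rsmul (-1) b)) by nc.
    apply K; [now apply selfadj_rsmul| |unfold t; lra].
    intros phi Hphi. specialize (H phi Hphi). destruct Hphi as [_ [Hm _]].
    unfold rsmul. rewrite Hm.
    pose proof (re_le_Cabs (Cmul (CofR (-1)) (phi b))).
    replace (Cabs (Cmul (CofR (-1)) (phi b))) with (Cabs (phi b)) in H0; [lra|].
    unfold Cabs; f_equal; simpl; ring.
Qed.

Section StateBounds.
Context {A : CStarAlg} (phi : A -> Cplx) (Hphi : is_state phi).

Lemma state_add x y : phi (add x y) = Cadd (phi x) (phi y).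
Proof. apply Hphi. Qed.
Lemma state_smul c x : phi (smul c x) = Cmul c (phi x).
Proof. apply Hphi. Qed.
Lemma state_rsmul r x : phi (rsmul r x) = Cmul (CofR r) (phi x).
Proof. apply Hphi. Qed.
Lemma state_one : phi one = Cone.
Proof. apply Hphi. Qed.

Lemma state_sub x y : phi (sub x y) = Csub (phi x) (phi y).
Proof.
  unfold sub. rewrite opp_smul, state_add, state_smul. apply Cplx_ext; simpl; ring.
Qed.

(** Polarization: 4h = (1 + h)^2 - (1 - h)^2, and states are real on squares by definition. *)
Lemma state_selfadj_real h : selfadj h -> im (phi h) = 0.
Proof.
  intros Sh. pose proof (@selfadj_one A) as S1.
  assert (E : h = smul (CofR (/4)) (sub (mul (star (add one h)) (add one h))
                                        (mul (star (sub one h)) (sub one h)))) by nc.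
  destruct Hphi as [_ [_ [Hp _]]].
  rewrite E, state_smul, state_sub. simpl.
  rewrite (proj1 (Hp (add one h))), (proj1 (Hp (sub one h))). ring.
Qed.

Lemma state_psd h : psd h -> 0 <= re (phi h).
Proof.
  intros Ph. destruct (psd_sqrt h Ph) as [s [[Ss _] [<- _]]].
  rewrite <- Ss at 1. apply Hphi.
Qed.

Lemma state_selfadj_le h : selfadj h -> re (phi h) <= norm h.
Proof.
  intros Sh. pose proof (state_psd _ (psd_norm_sub _ _ Sh (Rle_refl _))) as H.
  rewrite state_sub, state_rsmul, state_one in H. simpl in H. lra.
Qed.

Lemma state_star x : phi (star x) = Cconj (phi x).
Proof.
  rewrite (re_im_part x) at 2. pose proof (re_part_selfadj x) as S1.
  pose proof (im_part_selfadj x) as S2.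
  replace (star x) with (add (re_part x) (smul (mkC 0 (-1)) (im_part x)))
    by (unfold re_part, im_part; nc).
  rewrite !state_add, !state_smul. apply Cplx_ext; simpl;
  rewrite ?(state_selfadj_real _ S1), ?(state_selfadj_real _ S2); ring.
Qed.

(** For s > 0 the minimum is at t = 1/s. For s = 0 the expression is affine in t, and the chosen t
    makes it -1 unless C = 0. *)
Lemma quadratic_discriminant (X C s : R) : 0 <= C -> 0 <= s ->
  (forall t, 0 <= X - 2 * t * C + t * t * C * s) -> C <= X * s.
Proof.
  intros HC Hs H. destruct (Req_dec s 0) as [->|Ns].
  - destruct (Req_dec C 0); [lra|]. specialize (H ((X + 1) / (2 * C))).
    replace (2 * ((X + 1) / (2 * C)) * C) with (X + 1) in H by (field; lra). lra.
  - specialize (H (/ s)).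
    replace (X - 2 * / s * C + / s * / s * C * s) with (X - C / s) in H by (field; lra).
    apply Rmult_le_compat_r with (r := s) in H; [|lra].
    replace ((X - C / s) * s) with (X * s - C) in H by (field; lra). lra.
Qed.

Lemma state_cauchy_schwarz z x :
  re (phi (mul (star z) x)) * re (phi (mul (star z) x)) +
  im (phi (mul (star z) x)) * im (phi (mul (star z) x)) <=
  re (phi (mul (star x) x)) * re (phi (mul (star z) z)).
Proof.
  set (c := phi (mul (star z) x)).
  apply quadratic_discriminant.
  - nra.
  - apply Hphi.
  - intros t. set (d := Cmul (CofR (- t)) c).
    destruct Hphi as [_ [_ [Hp _]]].
    pose proof (proj2 (Hp (add x (smul d z)))) as H.
    replace (mul (star (add x (smul d z))) (add x (smul d z))) with
      (add (add (mul (star x) x) (smul d (star (mul (star z) x))))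
           (add (smul (Cconj d) (mul (star z) x)) (smul (Cmul (Cconj d) d) (mul (star z) z))))
      in H by nc.
    rewrite !state_add, !state_smul, state_star in H. fold c in H. simpl in H.
    pose proof (proj1 (Hp z)) as Z. rewrite Z in H.
    eapply Rle_trans; [exact H|]. right. ring.
Qed.

Lemma state_bound x : Cabs (phi x) <= norm x.
Proof.
  pose proof (state_cauchy_schwarz one x) as H.
  replace (mul (star one) x) with x in H by nc.
  replace (mul (star one) (@one A)) with (@one A) in H by nc.
  rewrite state_one in H. simpl in H.
  pose proof (state_selfadj_le _ (selfadj_star_mul x)) as H1. rewrite norm_cstar in H1.
  unfold Cabs. rewrite <- (sqrt_Rsqr (norm x)) by apply norm_nonneg.
  apply sqrt_le_1_alt. unfold Rsqr. lra.
Qed.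

Lemma sum_sq_zero (z : Cplx) : re z * re z + im z * im z <= 0 -> z = Czero.
Proof. intros H. apply Cplx_ext; simpl; nra. Qed.

Lemma state_null_l z x : phi (mul z (star z)) = Czero -> phi (mul z x) = Czero.
Proof.
  intros Hz. pose proof (state_cauchy_schwarz (star z) x) as H.
  rewrite star_star, Hz in H. simpl in H. apply sum_sq_zero. lra.
Qed.

Lemma state_null_r z x : phi (mul (star z) z) = Czero -> phi (mul x z) = Czero.
Proof.
  intros Hz. pose proof (state_cauchy_schwarz (star x) z) as H.
  rewrite star_star, Hz in H. simpl in H. apply sum_sq_zero. lra.
Qed.

End StateBounds.

(** By Cauchy-Schwarz, each of the two vanishing conditions makes phi vanish on multiples of 1 - w
    on one side. *)
Lemma one_level_mul {D : CStarAlg} (w : D) (phi : D -> Cplx) (x : D) : one_level w phi ->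
  phi (mul w x) = phi x /\ phi (mul x w) = phi x.
Proof.
  intros [H [H1 H2]]. split.
  - pose proof (state_null_l phi H _ x H2) as E.
    replace (mul w x) with (sub x (mul (sub one w) x)) by nc.
    rewrite state_sub, E by auto. apply Cplx_ext; simpl; ring.
  - pose proof (state_null_r phi H _ x H1) as E.
    replace (mul x w) with (sub x (mul x (sub one w))) by nc.
    rewrite state_sub, E by auto. apply Cplx_ext; simpl; ring.
Qed.

Lemma state_pullback {A D : CStarAlg} (p : A -> D) (phi : D -> Cplx) :
  unital_inj_star_hom p -> is_state phi -> is_state (fun a => phi (p a)).
Proof.
  intros [pa [ps [pm [pst [p1 _]]]]] [fa [fs [fp f1]]]. repeat split; intros.
  - now rewrite pa, fa.
  - now rewrite ps, fs.
  - rewrite pm, pst. apply fp.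
  - rewrite pm, pst. apply fp.
  - now rewrite p1.
Qed.

(** States of D pull back to states of A, whose values are bounded by the norm of A; the C*-identity
    reduces the claim to the self-adjoint x* x. *)
Lemma hom_contractive {A D : CStarAlg} (p : A -> D) (x : A) :
  unital_inj_star_hom p -> norm (p x) <= norm x.
Proof.
  intros Hp. assert (K : norm (p (mul (star x) x)) <= norm (mul (star x) x)).
  { apply norm_le_states.
    - destruct Hp as [_ [_ [_ [Hs _]]]]. unfold selfadj. rewrite <- Hs. f_equal. nc.
    - apply norm_nonneg.
    - intros phi Hphi.
      apply (state_bound (fun a => phi (p a))). now apply state_pullback. }
  destruct Hp as [_ [_ [Hm [Hs _]]]]. rewrite Hm, Hs, !norm_cstar in K.
  pose proof (norm_nonneg A x). pose proof (norm_nonneg D (p x)). nra.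
Qed.

(** * Ultrafilter limits *)

Lemma ultrafilter_exists : exists U : (nat -> Prop) -> Prop, nat_filter U /\
  (forall P, U P \/ U (fun n => ~ P n)) /\ (forall P, eventually P -> U P).
Proof.
  pose proof eventually_filter as EF.
  assert (PF : @filter.ProperFilter nat eventually).
  { constructor.
    - intros H. destruct (nf_ex _ EF _ H) as [n Hn]. exact Hn.
    - constructor.
      + apply (nf_all _ EF).
      + intros P Q. apply (nf_and _ EF).
      + intros P Q H. apply (nf_mono _ EF). exact H. }
  destruct (@filter.ultraFilterLemma nat eventually PF) as [U [HU Hle]].
  exists U. assert (PU := @filter.ultra_proper _ _ HU).
  pose proof (@filter.filter_filter _ _ PU) as FU.
  split; [|split].
  - constructor.
    + apply (@filter.filterT _ _ FU).
    + intros P Q H. apply (@filter.filterS _ _ FU). exact H.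
    + intros P Q. apply (@filter.filterI _ _ FU).
    + intros P HP. apply NNPP. intros N.
      apply (@filter.filter_not_empty _ _ PU).
      apply (@filter.filterS _ _ FU) with (2 := HP). intros n Hn. apply N. now exists n.
  - intros P. apply (@filter.in_ultra_setVsetC nat U P HU).
  - exact Hle.
Qed.

(** * The complex modulus *)

Lemma Cabs_sq (z : Cplx) : Cabs z * Cabs z = re z * re z + im z * im z.
Proof. apply sqrt_sqrt. nra. Qed.

Lemma Cabs_nonneg (z : Cplx) : 0 <= Cabs z.
Proof. apply sqrt_pos. Qed.

Lemma Cabs_le_sq (z : Cplx) (c : R) : 0 <= c -> re z * re z + im z * im z <= c * c ->
  Cabs z <= c.
Proof.
  intros Hc H. pose proof (Cabs_sq z). pose proof (Cabs_nonneg z). nra.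
Qed.

Lemma Cabs_triangle (x y : Cplx) : Cabs (Cadd x y) <= Cabs x + Cabs y.
Proof.
  pose proof (Cabs_nonneg x). pose proof (Cabs_nonneg y).
  pose proof (Cabs_sq x) as Ex. pose proof (Cabs_sq y) as Ey.
  assert (re x * re y + im x * im y <= Cabs x * Cabs y).
  { destruct (Rle_or_lt (re x * re y + im x * im y) 0); [nra|].
    apply Rsqr_incr_0; [unfold Rsqr| lra | nra].
    replace (Cabs x * Cabs y * (Cabs x * Cabs y))
      with ((re x * re x + im x * im x) * (re y * re y + im y * im y))
      by (rewrite <- Ex, <- Ey; ring).
    pose proof (Rle_0_sqr (re x * im y - im x * re y)) as S. unfold Rsqr in S. nra. }
  apply Cabs_le_sq; [lra|]. simpl. nra.
Qed.

Lemma Cabs_sub_triangle (x y z : Cplx) : Cabs (Csub x z) <= Cabs (Csub x y) + Cabs (Csub y z).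
Proof.
  replace (Csub x z) with (Cadd (Csub x y) (Csub y z)) by (apply Cplx_ext; simpl; ring).
  apply Cabs_triangle.
Qed.

Lemma Cabs_sub_sym (x y : Cplx) : Cabs (Csub x y) = Cabs (Csub y x).
Proof. unfold Cabs; simpl. f_equal; ring. Qed.

Lemma Cabs_mul (x y : Cplx) : Cabs (Cmul x y) = Cabs x * Cabs y.
Proof.
  unfold Cabs. rewrite <- sqrt_mult_alt by nra. f_equal; simpl; ring.
Qed.

Lemma Cabs_re_le (z : Cplx) : Rabs (re z) <= Cabs z.
Proof.
  unfold Cabs. rewrite <- sqrt_Rsqr_abs. apply sqrt_le_1_alt. unfold Rsqr. nra.
Qed.

Lemma Cabs_im_le (z : Cplx) : Rabs (im z) <= Cabs z.
Proof.
  unfold Cabs. rewrite <- sqrt_Rsqr_abs. apply sqrt_le_1_alt. unfold Rsqr. nra.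
Qed.

Lemma Cabs_le_re_im (z : Cplx) : Cabs z <= Rabs (re z) + Rabs (im z).
Proof.
  pose proof (Rabs_pos (re z)). pose proof (Rabs_pos (im z)).
  apply Cabs_le_sq; [lra|].
  pose proof (Rsqr_abs (re z)) as E1. pose proof (Rsqr_abs (im z)) as E2.
  unfold Rsqr in *. nra.
Qed.

Lemma inv_INR_pos (k : nat) : 0 < / (INR k + 1).
Proof. apply Rinv_0_lt_compat. pose proof (pos_INR k). lra. Qed.

Lemma inv_INR_small (eps : R) : 0 < eps -> eventually (fun k => / (INR k + 1) < eps).
Proof.
  intros He. destruct (INR_unbounded (/ eps)) as [N HN]. exists N. intros k Hk.
  apply le_INR in Hk. rewrite <- (Rinv_inv eps).
  apply Rinv_lt_contravar; [|lra].
  pose proof (Rinv_0_lt_compat _ He). pose proof (pos_INR k). nra.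
Qed.

Section UltraLimits.
Context {U : (nat -> Prop) -> Prop} (FU : nat_filter U)
  (UU : forall P, U P \/ U (fun n => ~ P n)).

(** The limit is the supremum of the r with r <= x n for U-many n; above it, the ultrafilter
    dichotomy turns failure into the opposite inequality. *)
Lemma ultra_real_limit (x : nat -> R) (c : R) : (forall n, Rabs (x n) <= c) ->
  exists l, forall eps, 0 < eps -> U (fun n => Rabs (x n - l) < eps).
Proof.
  intros Hx. assert (Hb : forall n, - c <= x n <= c).
  { intros n. specialize (Hx n). pose proof (Rle_abs (x n)).
    pose proof (Rle_abs (- x n)) as H'. rewrite Rabs_Ropp in H'. lra. }
  destruct (completeness (fun r => U (fun n => r <= x n))) as [l [H1 H2]].
  - exists c. intros r Hr. destruct (nf_ex U FU _ Hr) as [n Hn]. specialize (Hb n). lra.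
  - exists (- c). apply (nf_forall FU). intros n. apply Hb.
  - exists l. intros eps He.
    assert (L : U (fun n => l - eps < x n)).
    { apply NNPP. intros N. assert (l <= l - eps / 2); [|lra].
      apply H2. intros r Hr. apply Rnot_lt_le. intros Hlt. apply N.
      apply (nf_mono U FU) with (2 := Hr). intros n Hn. lra. }
    assert (G : U (fun n => ~ (l + eps / 2 <= x n))).
    { destruct (UU (fun n => l + eps / 2 <= x n)) as [H|H]; auto.
      specialize (H1 _ H). lra. }
    apply (nf_and_imp FU _ _ _) with (2 := L) (3 := G).
    intros n Hn Hm. apply Rabs_def1; lra.
Qed.

Definition ccvg (z : nat -> Cplx) (l : Cplx) : Prop :=
  forall eps, 0 < eps -> U (fun n => Cabs (Csub (z n) l) < eps).

Lemma ultra_complex_limit (z : nat -> Cplx) (c : R) : (forall n, Cabs (z n) <= c) ->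
  exists l, ccvg z l.
Proof.
  intros Hz.
  destruct (ultra_real_limit (fun n => re (z n)) c) as [a Ha].
  { intros n. eapply Rle_trans; [apply Cabs_re_le|apply Hz]. }
  destruct (ultra_real_limit (fun n => im (z n)) c) as [b Hb].
  { intros n. eapply Rle_trans; [apply Cabs_im_le|apply Hz]. }
  exists (mkC a b). intros eps He.
  apply (nf_and_imp FU _ _ _) with (2 := Ha (eps / 2) ltac:(lra)) (3 := Hb (eps / 2) ltac:(lra)).
  intros n H1 H2. eapply Rle_lt_trans; [apply Cabs_le_re_im|]. simpl. lra.
Qed.

Lemma ccvg_unique z l m : ccvg z l -> ccvg z m -> l = m.
Proof.
  intros Hl Hm.
  assert (E : Cabs (Csub l m) <= 0).
  { apply Rnot_lt_le. intros H.
    destruct (nf_ex U FU _ (nf_and U FU _ _ (Hl (Cabs (Csub l m) / 2) ltac:(lra))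
      (Hm (Cabs (Csub l m) / 2) ltac:(lra)))) as [n [H1 H2]].
    pose proof (Cabs_sub_triangle l (z n) m) as T. rewrite (Cabs_sub_sym l (z n)) in T. lra. }
  pose proof (Cabs_re_le (Csub l m)) as E1. pose proof (Cabs_im_le (Csub l m)) as E2.
  simpl in *. pose proof (Rle_abs (re l - re m)). pose proof (Rle_abs (im l - im m)).
  pose proof (Rle_abs (- (re l - re m))). pose proof (Rle_abs (- (im l - im m))).
  rewrite Rabs_Ropp in *. apply Cplx_ext; lra.
Qed.

Lemma ccvg_add z w l m : ccvg z l -> ccvg w m -> ccvg (fun n => Cadd (z n) (w n)) (Cadd l m).
Proof.
  intros Hl Hm eps He.
  apply (nf_and_imp FU _ _ _) with (2 := Hl (eps / 2) ltac:(lra)) (3 := Hm (eps / 2) ltac:(lra)).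
  intros n H1 H2.
  replace (Csub (Cadd (z n) (w n)) (Cadd l m)) with (Cadd (Csub (z n) l) (Csub (w n) m))
    by (apply Cplx_ext; simpl; ring).
  eapply Rle_lt_trans; [apply Cabs_triangle|]. lra.
Qed.

Lemma ccvg_mul c z l : ccvg z l -> ccvg (fun n => Cmul c (z n)) (Cmul c l).
Proof.
  intros Hl eps He. pose proof (Cabs_nonneg c) as Hc.
  assert (Hd : 0 < eps / (Cabs c + 1)) by (apply Rdiv_lt_0_compat; lra).
  apply (nf_mono U FU) with (2 := Hl _ Hd). intros n H.
  replace (Csub (Cmul c (z n)) (Cmul c l)) with (Cmul c (Csub (z n) l))
    by (apply Cplx_ext; simpl; ring).
  rewrite Cabs_mul. pose proof (Cabs_nonneg (Csub (z n) l)).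
  apply Rle_lt_trans with ((Cabs c + 1) * Cabs (Csub (z n) l)); [nra|].
  apply Rmult_lt_compat_l with (r := Cabs c + 1) in H; [|lra].
  replace ((Cabs c + 1) * (eps / (Cabs c + 1))) with eps in H by (field; lra). lra.
Qed.

Lemma ccvg_nonneg z l : ccvg z l -> (forall n, im (z n) = 0 /\ 0 <= re (z n)) ->
  im l = 0 /\ 0 <= re l.
Proof.
  intros Hl Hz.
  assert (K : forall eps, 0 < eps -> Rabs (im l) < eps /\ - eps < re l).
  { intros eps He. destruct (nf_ex U FU _ (Hl eps He)) as [n Hn].
    pose proof (Cabs_re_le (Csub (z n) l)) as H1. pose proof (Cabs_im_le (Csub (z n) l)) as H2.
    simpl in *. destruct (Hz n) as [Z1 Z2]. rewrite Z1 in H2.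
    replace (0 - im l) with (- im l) in H2 by ring. rewrite Rabs_Ropp in H2.
    pose proof (Rle_abs (re (z n) - re l)) as H3. split; [lra|].
    pose proof (Rle_abs (- (re (z n) - re l))) as H4. rewrite Rabs_Ropp in H4. lra. }
  split.
  - destruct (Req_dec (im l) 0) as [|N]; auto.
    pose proof (proj1 (K _ (Rabs_pos_lt _ N))). lra.
  - apply Rnot_lt_le. intros H. pose proof (proj2 (K (- re l) ltac:(lra))). lra.
Qed.

Lemma ccvg_ext z w l : (forall n, z n = w n) -> ccvg z l -> ccvg w l.
Proof.
  intros E H eps He. apply (nf_mono U FU) with (2 := H eps He). intros n. now rewrite E.
Qed.

(** Weak* compactness of the state space in sequential guise: pointwise limits exist by |f x| <=
    |x|, and the conditions defining a state pass to them. *)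
Lemma ultra_state_limit {A : CStarAlg} (f : nat -> A -> Cplx) : (forall n, is_state (f n)) ->
  exists phi, is_state phi /\ forall x, ccvg (fun n => f n x) (phi x).
Proof.
  intros Hf.
  destruct (choice (fun x l => ccvg (fun n => f n x) l)) as [phi Hphi].
  { intros x. apply ultra_complex_limit with (norm x). intros n. now apply state_bound. }
  exists phi. split; auto. split; [|split; [|split]].
  - intros x y. apply (ccvg_unique (fun n => f n (add x y))); auto.
    apply (ccvg_ext (fun n => Cadd (f n x) (f n y))); [|now apply ccvg_add].
    intros n. symmetry. now apply state_add.
  - intros c x. apply (ccvg_unique (fun n => f n (smul c x))); auto.
    apply (ccvg_ext (fun n => Cmul c (f n x))); [|now apply ccvg_mul].
    intros n. symmetry. now apply state_smul.
  - intros x. apply (ccvg_nonneg (fun n => f n (mul (star x) x))); auto.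
    intros n. apply (Hf n).
  - apply (ccvg_unique (fun n => f n one)); auto.
    intros eps He. apply (nf_forall FU). intros n. rewrite (state_one _ (Hf n)).
    replace (Csub Cone Cone) with Czero by (apply Cplx_ext; simpl; ring).
    unfold Czero. rewrite Cabs_CofR, Rabs_R0. auto.
Qed.

Lemma nf_forall_list {T : Type} (P : T -> nat -> Prop) (l : list T) :
  (forall x, In x l -> U (P x)) -> U (fun n => forall x, In x l -> P x n).
Proof.
  induction l as [|y l IH]; intros H.
  - apply (nf_forall FU). intros n x [].
  - apply (nf_and_imp FU _ _ _) with (2 := H y (or_introl eq_refl))
      (3 := IH (fun x Hx => H x (or_intror Hx))).
    intros n H1 H2 x [<-|Hx]; auto.
Qed.

(** * Compactness of Lipschitz balls *)

Section Compactness.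
Context {A : CStarAlg} (L : A -> ext) (HL : is_LQCMS A L)
  (UE : forall P, eventually P -> U P).

Lemma mk_le_sym phi psi r : mk_le L phi psi r -> mk_le L psi phi r.
Proof. intros H a Sa La. rewrite Cabs_sub_sym. auto. Qed.

Lemma mk_le_trans phi psi chi r s : mk_le L phi psi r -> mk_le L psi chi s ->
  mk_le L phi chi (r + s).
Proof.
  intros H1 H2 a Sa La. specialize (H1 a Sa La). specialize (H2 a Sa La).
  pose proof (Cabs_sub_triangle (phi a) (psi a) (chi a)). lra.
Qed.

Lemma mk_le_refl phi : mk_le L phi phi 0.
Proof.
  intros a _ _. replace (Csub _ _) with Czero by (apply Cplx_ext; simpl; ring).
  unfold Czero. rewrite Cabs_CofR, Rabs_R0. lra.
Qed.

Lemma mk_ball_open phi r : mk_open L (fun psi => mk_lt L phi psi r).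
Proof.
  intros psi _ [s [Hs H]]. exists (r - s). split; [lra|].
  intros chi _ [s' [Hs' H']]. exists (s + s'). split; [lra|].
  now apply mk_le_trans with psi.
Qed.

(** Without a finite net there is a sequence of states pairwise more than eps apart. Its ultrafilter
    limit is a weak* limit, and Monge-Kantorovich balls are weak* open, so two of its terms lie in
    the eps/2-ball around the limit. *)
Lemma states_totally_bounded eps : 0 < eps ->
  exists l : list (A -> Cplx), (forall psi, In psi l -> is_state psi) /\
    forall phi, is_state phi -> exists psi, In psi l /\ mk_le L phi psi eps.
Proof.
  intros He. apply NNPP. intros N.
  (* The condition on [l] stands under the existential so that [choice] gives a function on all
     lists; [Czero] serves lists containing a non-state. *)
  assert (K : forall l : list (A -> Cplx), exists phi, (forall psi, In psi l -> is_state psi) ->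
     is_state phi /\ forall psi, In psi l -> ~ mk_le L phi psi eps).
  { intros l. apply NNPP. intros N'. apply N. exists l. split.
    - apply NNPP. intros N2. apply N'. exists (fun _ => Czero). tauto.
    - intros phi Hphi. apply NNPP. intros N2. apply N'. exists phi. intros _.
      split; auto. intros psi Hpsi Hm. apply N2. now exists psi. }
  destruct (choice _ K) as [f Hf].
  (* [ls n] collects the states chosen before stage n, and [f (ls n)] is the next one, far from all
     of them. *)
  set (ls := fix ls n := match n with O => nil | S n => f (ls n) :: ls n end).
  assert (Hls : forall n psi, In psi (ls n) -> is_state psi).
  { induction n; simpl; [tauto|]. intros psi [<-|H]; auto. exact (proj1 (Hf (ls n) IHn)). }
  assert (Hin : forall m n, (m < n)%nat -> In (f (ls m)) (ls n)).
  { intros m n. induction 1; simpl; auto. }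
  assert (Hs : forall n, is_state (f (ls n))) by (intros n; exact (proj1 (Hf (ls n) (Hls n)))).
  destruct (ultra_state_limit (fun n => f (ls n)) Hs) as [phi [Hphi Hlim]].
  assert (W : weakstar_open (fun psi => mk_lt L phi psi (eps / 2))).
  { apply HL. apply mk_ball_open. }
  destruct (W phi Hphi) as [F [d [Hd HF]]].
  { exists 0. split; [lra|]. apply mk_le_refl. }
  assert (HU : U (fun n => mk_lt L phi (f (ls n)) (eps / 2))).
  { apply (nf_mono U FU (fun n => forall a, In a F -> Cabs (Csub (f (ls n) a) (phi a)) < d)).
    - intros n Hn. apply HF; auto.
    - apply nf_forall_list. intros a _. now apply Hlim. }
  destruct (nf_ex U FU _ HU) as [m [s [Hs1 Hm]]].
  assert (HE : U (fun n => (m < n)%nat)).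
  { apply UE. exists (S m). intros n Hn. lia. }
  destruct (nf_ex U FU _ (nf_and U FU _ _ HU HE)) as [n [[s' [Hs1' Hn]] Hmn]].
  apply (proj2 (Hf (ls n) (Hls n)) (f (ls m))); [now apply Hin|].
  intros a Sa La.
  pose proof (mk_le_trans _ _ _ _ _ (mk_le_sym _ _ _ Hn) Hm a Sa La). lra.
Qed.

Lemma lip_le_selfadj a r : lip_le L a r -> selfadj a.
Proof. intros [l [E _]]. apply HL. congruence. Qed.

Lemma lip_le_nonneg a r : lip_le L a r -> 0 <= r.
Proof.
  intros [l [E H]]. destruct HL as [_ [_ [_ [Hp _]]]]. specialize (Hp _ _ E). lra.
Qed.

Lemma lip_le_rsmul a r s : lip_le L a r -> lip_le L (rsmul s a) (Rabs s * r).
Proof.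
  intros [l [E H]]. destruct HL as [_ [_ [Hh _]]]. exists (Rabs s * l).
  split; [now apply Hh|]. pose proof (Rabs_pos s). nra.
Qed.

Lemma lip_le_add a b r s : lip_le L a r -> lip_le L b s -> lip_le L (add a b) (r + s).
Proof.
  intros [l [E H]] [m [E' H']]. destruct HL as [_ [Ha _]].
  destruct (Ha _ _ _ _ E E') as [k [Ek Hk]]. exists k. split; auto; lra.
Qed.

Lemma lip_le_weaken a r s : lip_le L a r -> r <= s -> lip_le L a s.
Proof. intros [l [E H]] Hs. exists l. split; auto; lra. Qed.

Lemma mk_le_scaled phi psi r a l : is_state phi -> is_state psi -> mk_le L phi psi r ->
  lip_le L a l -> Cabs (Csub (phi a) (psi a)) <= l * r.
Proof.
  intros Hphi Hpsi Hm Ha. pose proof (lip_le_nonneg _ _ Ha) as Hl.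
  pose proof (lip_le_selfadj _ _ Ha) as Sa.
  (* At level 0 there is no rescaling by 1/l, but the element is a scalar, on which all states
     agree. *)
  destruct (Req_dec l 0) as [->|Nl].
  - destruct Ha as [l0 [E H0]].
    assert (l0 = 0).
    { apply Rle_antisym; auto. destruct HL as [_ [_ [_ [Hp _]]]]. now apply (Hp a). }
    subst l0. destruct HL as [_ [_ [_ [_ [_ [Hz _]]]]]].
    destruct (proj1 (Hz a) E) as [s ->].
    rewrite !state_rsmul, !state_one by auto.
    replace (Csub _ _) with Czero by (apply Cplx_ext; simpl; ring).
    unfold Czero. rewrite Cabs_CofR, Rabs_R0. lra.
  - assert (lpos : 0 < l) by lra. pose proof (Rinv_0_lt_compat l lpos) as ip.
    assert (H1 : lip_le L (rsmul (/ l) a) 1).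
    { replace 1 with (Rabs (/ l) * l); [now apply lip_le_rsmul|].
      rewrite Rabs_right by lra. field; lra. }
    specialize (Hm _ (selfadj_rsmul _ _ Sa) H1).
    rewrite !state_rsmul in Hm by auto.
    replace (Csub _ _) with (Cmul (CofR (/ l)) (Csub (phi a) (psi a))) in Hm
      by (apply Cplx_ext; simpl; ring).
    rewrite Cabs_mul, Cabs_CofR, Rabs_right in Hm by lra.
    apply Rmult_le_compat_l with (r := l) in Hm; [|lra].
    rewrite <- Rmult_assoc, Rinv_r in Hm by lra. lra.
Qed.

(* Arzela-Ascoli over the compact state space, where the norm is the supremum. *)
Lemma lip_ball_ultra_cauchy (b : nat -> A) (l K : R) : (forall n, lip_le L (b n) l) ->
  (forall n, norm (b n) <= K) ->
  forall eps, 0 < eps -> exists m, U (fun n => norm (sub (b n) (b m)) <= eps).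
Proof.
  intros Hb HK eps He.
  assert (Hl : 0 <= l) by (apply (lip_le_nonneg _ _ (Hb O))).
  (* Four errors arise, from phi to psi and from psi to its limit value, at both [b n] and [b m];
     each is at most eps/8. Using [l + 1] allows l = 0. *)
  set (e := eps / (8 * (l + 1))).
  assert (He' : 0 < e) by (apply Rdiv_lt_0_compat; lra).
  assert (Ee : l * e <= eps / 8).
  { apply Rle_trans with ((l + 1) * e); [nra|]. right. unfold e. field. lra. }
  destruct (states_totally_bounded e He') as [F [HF Hnet]].
  assert (Hlim : forall psi, exists z, In psi F -> ccvg (fun n => psi (b n)) z).
  { intros psi. destruct (classic (In psi F)) as [Hin|Hin].
    - destruct (ultra_complex_limit (fun n => psi (b n)) K) as [z Hz].
      + intros n. eapply Rle_trans; [apply state_bound; auto|auto].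
      + now exists z.
    - exists Czero. tauto. }
  destruct (choice _ Hlim) as [z Hz].
  assert (HU : U (fun n => forall psi, In psi F -> Cabs (Csub (psi (b n)) (z psi)) < eps / 8)).
  { apply nf_forall_list. intros psi Hin. apply Hz; auto; lra. }
  destruct (nf_ex U FU _ HU) as [m Hm]. exists m.
  apply (nf_mono U FU) with (2 := HU). intros n Hn.
  apply norm_le_states; [apply selfadj_sub; eapply lip_le_selfadj; apply Hb|lra|].
  intros phi Hphi. rewrite state_sub by auto.
  destruct (Hnet phi Hphi) as [psi [Hin Hpsi]].
  specialize (Hm psi Hin). specialize (Hn psi Hin).
  pose proof (mk_le_scaled _ _ _ _ _ Hphi (HF _ Hin) Hpsi (Hb n)) as M1.
  pose proof (mk_le_scaled _ _ _ _ _ Hphi (HF _ Hin) Hpsi (Hb m)) as M2.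
  pose proof (Cabs_sub_triangle (phi (b n)) (psi (b n)) (phi (b m))) as T1.
  pose proof (Cabs_sub_triangle (psi (b n)) (z psi) (phi (b m))) as T2.
  pose proof (Cabs_sub_triangle (z psi) (psi (b m)) (phi (b m))) as T3.
  rewrite (Cabs_sub_sym (z psi) (psi (b m))) in T3.
  rewrite (Cabs_sub_sym (psi (b m)) (phi (b m))) in T3. lra.
Qed.

(** Centres [b (m k)] are chosen with U-many terms within 1/(k+1). Any two members of U meet, so the
    centres form a Cauchy sequence, and its limit is the ultrafilter limit. *)
Lemma lip_ball_ultra_limit (b : nat -> A) (l K : R) : (forall n, lip_le L (b n) l) ->
  (forall n, norm (b n) <= K) -> exists x, cvg U b x.
Proof.
  intros Hb HK. pose proof (lip_ball_ultra_cauchy b l K Hb HK) as HC.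
  destruct (choice (fun k m => U (fun n => norm (sub (b n) (b m)) <= / (INR k + 1))))
    as [m Hm].
  { intros k. apply HC, inv_INR_pos. }
  destruct (complete A (fun k => b (m k))) as [x Hx].
  { intros eps He. destruct (inv_INR_small (eps / 2) ltac:(lra)) as [N HN]. exists N.
    intros i j Hi Hj. fold (sub (b (m i)) (b (m j))).
    destruct (nf_ex U FU _ (nf_and U FU _ _ (Hm i) (Hm j))) as [n [H1 H2]].
    pose proof (norm_sub_triangle (b (m i)) (b n) (b (m j))) as T.
    rewrite (norm_sub_sym (b (m i)) (b n)) in T.
    pose proof (HN i Hi). pose proof (HN j Hj). lra. }
  exists x. intros eps He.
  destruct (inv_INR_small (eps / 2) ltac:(lra)) as [N HN].
  destruct (Hx (eps / 2) ltac:(lra)) as [M HM].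
  specialize (HN (N + M)%nat ltac:(lia)). specialize (HM (N + M)%nat ltac:(lia)).
  apply (nf_mono U FU) with (2 := Hm (N + M)%nat). intros n Hn.
  pose proof (norm_sub_triangle (b n) (b (m (N + M)%nat)) x). unfold sub in *. lra.
Qed.

(** Lower semi-continuity speaks of sequences, so terms within 1/(k+1) of x are extracted first. *)
Lemma lip_le_ultra_limit (b : nat -> A) (x : A) (l : R) : (forall n, lip_le L (b n) l) ->
  cvg U b x -> lip_le L x l.
Proof.
  intros Hb Hx.
  destruct (choice (fun k n => norm (sub (b n) x) < / (INR k + 1))) as [m Hm].
  { intros k. apply (nf_ex U FU), Hx, inv_INR_pos. }
  destruct HL as [_ [_ [_ [_ [_ [_ [_ [_ [Hlsc _]]]]]]]]].
  apply (Hlsc (fun k => b (m k))); [|intros; apply Hb].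
  intros eps He. destruct (inv_INR_small eps He) as [N HN]. exists N. intros k Hk.
  eapply Rlt_trans; [apply Hm|auto].
Qed.

End Compactness.
End UltraLimits.

(** * Correspondences induced by treks *)

Definition jordan {A : CStarAlg} (a b : A) : A := rsmul (/2) (add (mul a b) (mul b a)).
Definition lie {A : CStarAlg} (a b : A) : A :=
  smul (mkC 0 (-(/2))) (sub (mul a b) (mul b a)).

Lemma norm_half_combination {A : CStarAlg} (x y : A) (c : R) : norm x <= c -> norm y <= c ->
  norm (rsmul (/2) (add x y)) <= c /\ norm (smul (mkC 0 (-(/2))) (sub x y)) <= c.
Proof.
  intros Hx Hy. split.
  - rewrite norm_rsmul, Rabs_right by lra. pose proof (norm_triangle A x y). lra.
  - rewrite norm_smul. replace (Cabs (mkC 0 (-(/2)))) with (/2).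
    + pose proof (norm_sub_triangle x zero y) as T.
      replace (sub x zero) with x in T by nc.
      rewrite (norm_sub_sym zero y) in T. replace (sub y zero) with y in T by nc. lra.
    + unfold Cabs; simpl. replace (0 * 0 + - / 2 * - / 2) with (/2 * /2) by ring.
      rewrite sqrt_square; lra.
Qed.

Lemma lip_le_leibniz (X : LQCMS) (a b : X) (l m K M : R) :
  lip_le (lip X) a l -> lip_le (lip X) b m -> norm a <= K -> norm b <= M ->
  lip_le (lip X) (jordan a b) (K * m + M * l) /\ lip_le (lip X) (lie a b) (K * m + M * l).
Proof.
  intros Ha Hb HK HM. pose proof (lqcms_prop X) as HX.
  pose proof (lip_le_selfadj _ HX _ _ Ha) as Sa. pose proof (lip_le_selfadj _ HX _ _ Hb) as Sb.
  destruct Ha as [la [Ea La]]. destruct Hb as [lb [Eb Lb]].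
  assert (0 <= la /\ 0 <= lb) as [La0 Lb0].
  { destruct HX as [_ [_ [_ [Hp _]]]]. split; [now apply (Hp a)|now apply (Hp b)]. }
  pose proof (norm_nonneg X a). pose proof (norm_nonneg X b).
  assert (norm a * lb + norm b * la <= K * m + M * l).
  { assert (norm a * lb <= K * m) by (apply Rmult_le_compat; auto).
    assert (norm b * la <= M * l) by (apply Rmult_le_compat; auto). lra. }
  destruct HX as [_ [_ [_ [_ [_ [_ [_ [_ [_ HL]]]]]]]]].
  destruct (HL a b la lb Sa Sb Ea Eb) as [HJ HI].
  split; eapply lip_le_weaken; eauto.
Qed.

(* [T a b l] plays the role of "b is in the target set of a at Lipschitz level l". *)
Record correspondence (X Y : LQCMS) (s : R) (T : X -> Y -> R -> Prop) : Prop := {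
  corr_nonneg : 0 <= s;
  corr_lip_l : forall a b l, T a b l -> lip_le (lip X) a l;
  corr_lip_r : forall a b l, T a b l -> lip_le (lip Y) b l;
  corr_total_l : forall a l, lip_le (lip X) a l -> exists b, T a b l;
  corr_total_r : forall b l, lip_le (lip Y) b l -> exists a, T a b l;
  corr_norm_l : forall a b l, T a b l -> norm a <= norm b + 2 * l * s;
  corr_norm_r : forall a b l, T a b l -> norm b <= norm a + 2 * l * s;
  corr_add : forall a b l a' b' l', T a b l -> T a' b' l' -> T (add a a') (add b b') (l + l');
  corr_rsmul : forall r a b l, T a b l -> T (rsmul r a) (rsmul r b) (Rabs r * l);
  corr_leibniz : forall a b l a' b' l' K K', T a b l -> T a' b' l' ->
    norm a + 2 * l * s <= K -> norm a' + 2 * l' * s <= K' ->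
    T (jordan a a') (jordan b b') (K * l' + K' * l) /\
    T (lie a a') (lie b b') (K * l' + K' * l)
}.

(** In the Leibniz clause a bound K >= |a| + 2l(s + t) also satisfies K >= |b| + 2lt for the
    intermediate b, so the same K, and hence the same level, serves on both legs. *)
Lemma correspondence_comp (X Y Z : LQCMS) (s t : R) (T : X -> Y -> R -> Prop)
  (V : Y -> Z -> R -> Prop) : correspondence X Y s T -> correspondence Y Z t V ->
  correspondence X Z (s + t) (fun a c l => exists b, T a b l /\ V b c l).
Proof.
  intros HT HV. pose proof (corr_nonneg _ _ _ _ HT). pose proof (corr_nonneg _ _ _ _ HV).
  split.
  - lra.
  - intros a c l [b [Hb Hc]]. now apply (corr_lip_l _ _ _ _ HT) in Hb.
  - intros a c l [b [Hb Hc]]. now apply (corr_lip_r _ _ _ _ HV) in Hc.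
  - intros a l Ha. destruct (corr_total_l _ _ _ _ HT a l Ha) as [b Hb].
    destruct (corr_total_l _ _ _ _ HV b l) as [c Hc]; [now apply (corr_lip_r _ _ _ _ HT a)|].
    now exists c, b.
  - intros c l Hc. destruct (corr_total_r _ _ _ _ HV c l Hc) as [b Hb].
    destruct (corr_total_r _ _ _ _ HT b l) as [a Ha]; [now apply (corr_lip_l _ _ _ _ HV b c)|].
    now exists a, b.
  - intros a c l [b [Hb Hc]]. apply (corr_norm_l _ _ _ _ HT) in Hb.
    apply (corr_norm_l _ _ _ _ HV) in Hc. lra.
  - intros a c l [b [Hb Hc]]. apply (corr_norm_r _ _ _ _ HT) in Hb.
    apply (corr_norm_r _ _ _ _ HV) in Hc. lra.
  - intros a c l a' c' l' [b [Hb Hc]] [b' [Hb' Hc']]. exists (add b b').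
    split; [now apply (corr_add _ _ _ _ HT)|now apply (corr_add _ _ _ _ HV)].
  - intros r a c l [b [Hb Hc]]. exists (rsmul r b).
    split; [now apply (corr_rsmul _ _ _ _ HT)|now apply (corr_rsmul _ _ _ _ HV)].
  - intros a c l a' c' l' K K' [b [Hb Hc]] [b' [Hb' Hc']] HK HK'.
    pose proof (lip_le_nonneg _ (lqcms_prop X) _ _ (corr_lip_l _ _ _ _ HT _ _ _ Hb)) as L0.
    pose proof (lip_le_nonneg _ (lqcms_prop X) _ _ (corr_lip_l _ _ _ _ HT _ _ _ Hb')) as L0'.
    pose proof (corr_norm_r _ _ _ _ HT _ _ _ Hb) as N.
    pose proof (corr_norm_r _ _ _ _ HT _ _ _ Hb') as N'.
    assert (0 <= l * t) by now apply Rmult_le_pos.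
    assert (0 <= l' * t) by now apply Rmult_le_pos.
    destruct (corr_leibniz _ _ _ _ HT _ _ _ _ _ _ K K' Hb Hb') as [J1 L1]; try lra.
    destruct (corr_leibniz _ _ _ _ HV _ _ _ _ _ _ K K' Hc Hc') as [J2 L2]; try lra.
    split; [exists (jordan b b')|exists (lie b b')]; now split.
Qed.

(** * The correspondence of a single bridge *)

Section BridgeCorrespondence.
Context {X Y : LQCMS} (g : Bridge X Y) (r s : R) (Hg : length_le g r) (Hs : r < s).
Let D : CStarAlg := br_D g.
Let w : D := br_w g.
Let pA : X -> D := br_pA g.
Let pB : Y -> D := br_pB g.

Lemma hom_rsmul {A E : CStarAlg} (p : A -> E) t x :
  unital_inj_star_hom p -> p (rsmul t x) = rsmul t (p x).
Proof. intros H. apply H. Qed.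

Lemma hom_sub {A E : CStarAlg} (p : A -> E) x y :
  unital_inj_star_hom p -> p (sub x y) = sub (p x) (p y).
Proof.
  intros [pa [ps _]]. unfold sub. rewrite !opp_smul. now rewrite pa, ps.
Qed.

Lemma hom_jordan {A E : CStarAlg} (p : A -> E) x y :
  unital_inj_star_hom p -> p (jordan x y) = jordan (p x) (p y).
Proof.
  intros H. unfold jordan. rewrite hom_rsmul by auto. destruct H as [pa [_ [pm _]]].
  now rewrite pa, !pm.
Qed.

Lemma hom_lie {A E : CStarAlg} (p : A -> E) x y :
  unital_inj_star_hom p -> p (lie x y) = lie (p x) (p y).
Proof.
  intros H. unfold lie. pose proof H as [_ [ps [pm _]]].
  now rewrite ps, hom_sub, !pm.
Qed.

(** The defect is some s > r, because a Hausdorff distance at most r provides partners only within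
    each s beyond r. *)
Definition bridge_rel (a : X) (b : Y) (l : R) : Prop :=
  lip_le (lip X) a l /\ lip_le (lip Y) b l /\
  norm (sub (mul (pA a) w) (mul w (pB b))) <= l * s.

Lemma pivot_state_close f (a : X) (b : Y) l : one_level w f -> bridge_rel a b l ->
  Cabs (Csub (f (pA a)) (f (pB b))) <= l * s.
Proof.
  intros Hf [_ [_ H]].
  destruct (one_level_mul w f (pA a) Hf) as [_ E1].
  destruct (one_level_mul w f (pB b) Hf) as [E2 _].
  rewrite <- E1, <- E2. destruct Hf as [Hf _].
  rewrite <- state_sub by auto. eapply Rle_trans; [now apply state_bound|auto].
Qed.

(** The factor 2: one [l s] is the height, for replacing a state of Y by one pulled back from the
    1-level, and the other is the reach, for moving from b to a under that state. *)
Lemma bridge_norm_r a b l : bridge_rel a b l -> norm b <= norm a + 2 * l * s.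
Proof.
  intros H. pose proof (lqcms_prop Y) as HY.
  assert (H0 : 0 <= l * s) by (eapply Rle_trans; [|apply H]; apply norm_nonneg).
  apply norm_le_states.
  - eapply lip_le_selfadj; [exact HY|apply H].
  - pose proof (norm_nonneg X a). lra.
  - intros phi Hphi. destruct Hg as [_ [_ [Hh _]]].
    destruct (Hh phi Hphi s Hs) as [psi [[f [Hf ->]] [s' [Hs' Hm]]]].
    assert (Sf : is_state (fun y => f (pB y)))
      by (apply state_pullback; [apply br_pB_hom|apply Hf]).
    assert (SfA : is_state (fun y => f (pA y)))
      by (apply state_pullback; [apply br_pA_hom|apply Hf]).
    pose proof (lip_le_nonneg _ HY _ _ (proj1 (proj2 H))) as L0.
    assert (M : Cabs (Csub (phi b) (f (pB b))) <= l * s).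
    { apply Rle_trans with (l * s'); [|nra].
      apply (mk_le_scaled _ HY phi (fun y => f (pB y)) s'); auto. apply H. }
    pose proof (pivot_state_close f a b l Hf H) as P.
    pose proof (state_bound _ SfA a) as B. simpl in B.
    pose proof (Cabs_triangle (Csub (phi b) (f (pB b)))
      (Cadd (Csub (f (pB b)) (f (pA a))) (f (pA a)))) as T1.
    pose proof (Cabs_triangle (Csub (f (pB b)) (f (pA a))) (f (pA a))) as T2.
    rewrite (Cabs_sub_sym (f (pB b))) in T2.
    replace (Cadd (Csub (phi b) (f (pB b))) (Cadd (Csub (f (pB b)) (f (pA a))) (f (pA a))))
      with (phi b) in T1 by (apply Cplx_ext; simpl; ring).
    lra.
Qed.

Lemma bridge_norm_l a b l : bridge_rel a b l -> norm a <= norm b + 2 * l * s.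
Proof.
  intros H. pose proof (lqcms_prop X) as HX.
  assert (H0 : 0 <= l * s) by (eapply Rle_trans; [|apply H]; apply norm_nonneg).
  apply norm_le_states.
  - eapply lip_le_selfadj; [exact HX|apply H].
  - pose proof (norm_nonneg Y b). lra.
  - intros phi Hphi. destruct Hg as [_ [[Hh _] _]].
    destruct (Hh phi Hphi s Hs) as [psi [[f [Hf ->]] [s' [Hs' Hm]]]].
    assert (Sf : is_state (fun y => f (pA y)))
      by (apply state_pullback; [apply br_pA_hom|apply Hf]).
    assert (SfB : is_state (fun y => f (pB y)))
      by (apply state_pullback; [apply br_pB_hom|apply Hf]).
    pose proof (lip_le_nonneg _ HX _ _ (proj1 H)) as L0.
    assert (M : Cabs (Csub (phi a) (f (pA a))) <= l * s).
    { apply Rle_trans with (l * s'); [|nra].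
      apply (mk_le_scaled _ HX phi (fun y => f (pA y)) s'); auto. apply H. }
    pose proof (pivot_state_close f a b l Hf H) as P.
    pose proof (state_bound _ SfB b) as B. simpl in B.
    pose proof (Cabs_triangle (Csub (phi a) (f (pA a)))
      (Cadd (Csub (f (pA a)) (f (pB b))) (f (pB b)))) as T1.
    pose proof (Cabs_triangle (Csub (f (pA a)) (f (pB b))) (f (pB b))) as T2.
    replace (Cadd (Csub (phi a) (f (pA a))) (Cadd (Csub (f (pA a)) (f (pB b))) (f (pB b))))
      with (phi a) in T1 by (apply Cplx_ext; simpl; ring).
    lra.
Qed.

Lemma lip_le_zero_scalar (Z : LQCMS) (a : Z) : lip_le (lip Z) a 0 -> exists t, a = rsmul t one.
Proof.
  intros [l [E H]]. destruct (lqcms_prop Z) as [_ [_ [_ [Hp [_ [Hz _]]]]]].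
  apply Hz. replace 0 with l; auto. apply Rle_antisym; auto. now apply (Hp a).
Qed.

Lemma lip_le_scalar (Z : LQCMS) (t : R) : lip_le (lip Z) (rsmul t one) 0.
Proof.
  exists 0. split; [|lra]. destruct (lqcms_prop Z) as [_ [_ [_ [_ [_ [Hz _]]]]]].
  apply Hz. now exists t.
Qed.

(** Covers level 0 in the totality lemmas, where elements cannot be normalized to the Lipschitz unit
    ball, the only one that the reach mentions. *)
Lemma bridge_rel_scalar t : bridge_rel (rsmul t one) (rsmul t one) 0.
Proof.
  split; [apply lip_le_scalar|split; [apply lip_le_scalar|]].
  unfold pA, pB. rewrite !hom_rsmul by apply g.
  destruct (br_pA_hom _ _ g) as [_ [_ [_ [_ [E _]]]]].
  destruct (br_pB_hom _ _ g) as [_ [_ [_ [_ [E' _]]]]].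
  rewrite E, E'. replace (sub _ _) with (@zero D) by nc. rewrite norm_zero. lra.
Qed.

Lemma bridge_rel_rsmul t a b l : bridge_rel a b l ->
  bridge_rel (rsmul t a) (rsmul t b) (Rabs t * l).
Proof.
  intros [H1 [H2 H3]]. split; [|split].
  - apply lip_le_rsmul; auto. apply lqcms_prop.
  - apply lip_le_rsmul; auto. apply lqcms_prop.
  - unfold pA, pB. rewrite !hom_rsmul by apply g. fold pA pB.
    replace (sub _ _) with (rsmul t (sub (mul (pA a) w) (mul w (pB b)))) by nc.
    rewrite norm_rsmul, Rmult_assoc. apply Rmult_le_compat_l; auto. apply Rabs_pos.
Qed.

Lemma lip_le_normalize (Z : LQCMS) (a : Z) l : 0 < l -> lip_le (lip Z) a l ->
  lip_le (lip Z) (rsmul (/ l) a) 1.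
Proof.
  intros Hl Ha. replace 1 with (Rabs (/ l) * l).
  - apply lip_le_rsmul; auto. apply lqcms_prop.
  - rewrite Rabs_right by (apply Rle_ge, Rlt_le, Rinv_0_lt_compat; lra). field; lra.
Qed.

Lemma bridge_total_l a l : lip_le (lip X) a l -> exists b, bridge_rel a b l.
Proof.
  intros Ha. pose proof (lip_le_nonneg _ (lqcms_prop X) _ _ Ha) as L0.
  destruct (Req_dec l 0) as [->|Nl].
  - destruct (lip_le_zero_scalar X a Ha) as [t ->]. exists (rsmul t one).
    apply bridge_rel_scalar.
  - assert (Hl : 0 < l) by lra.
    pose proof (lip_le_normalize X a l Hl Ha) as H1.
    destruct Hg as [[Hr _] _].
    destruct (Hr (mul (pA (rsmul (/ l) a)) w)) with (s := s) as [y [[b [Sb [Lb ->]]] Hy]]; auto.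
    { exists (rsmul (/ l) a). repeat split; auto.
      eapply lip_le_selfadj; [apply lqcms_prop|exact H1]. }
    exists (rsmul l b).
    assert (H : bridge_rel (rsmul (/ l) a) b 1).
    { split; [|split]; auto. rewrite Rmult_1_l. apply Rlt_le. exact Hy. }
    apply (bridge_rel_rsmul l) in H.
    rewrite Rabs_right, Rmult_1_r in H by lra.
    replace (rsmul l (rsmul (/ l) a)) with a in H by nc. exact H.
Qed.

Lemma bridge_total_r b l : lip_le (lip Y) b l -> exists a, bridge_rel a b l.
Proof.
  intros Hb. pose proof (lip_le_nonneg _ (lqcms_prop Y) _ _ Hb) as L0.
  destruct (Req_dec l 0) as [->|Nl].
  - destruct (lip_le_zero_scalar Y b Hb) as [t ->]. exists (rsmul t one).
    apply bridge_rel_scalar.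
  - assert (Hl : 0 < l) by lra.
    pose proof (lip_le_normalize Y b l Hl Hb) as H1.
    destruct Hg as [[_ Hr] _].
    destruct (Hr (mul w (pB (rsmul (/ l) b)))) with (s := s) as [x [[a [Sa [La ->]]] Hx]]; auto.
    { exists (rsmul (/ l) b). repeat split; auto.
      eapply lip_le_selfadj; [apply lqcms_prop|exact H1]. }
    exists (rsmul l a).
    assert (H : bridge_rel a (rsmul (/ l) b) 1).
    { split; [|split]; auto. rewrite Rmult_1_l. apply Rlt_le. exact Hx. }
    apply (bridge_rel_rsmul l) in H.
    rewrite Rabs_right, Rmult_1_r in H by lra.
    replace (rsmul l (rsmul (/ l) b)) with b in H by nc. exact H.
Qed.

(** Telescoping, with images in D understood: a a' w - w b b' = a (a' w - w b') + (a w - w b) b'.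
    Norms are thus needed for a on one side and b' on the other. *)
Lemma bridge_mul a b l a' b' l' K K' : bridge_rel a b l -> bridge_rel a' b' l' ->
  norm a <= K -> norm b' <= K' ->
  norm (sub (mul (mul (pA a) (pA a')) w) (mul w (mul (pB b) (pB b'))))
    <= (K * l' + K' * l) * s.
Proof.
  intros [_ [_ H]] [_ [_ H']] HK HK'.
  replace (sub _ _) with (add (mul (pA a) (sub (mul (pA a') w) (mul w (pB b'))))
                              (mul (sub (mul (pA a) w) (mul w (pB b))) (pB b'))) by nc.
  eapply Rle_trans; [apply norm_triangle|].
  pose proof (hom_contractive pA a (br_pA_hom _ _ g)).
  pose proof (hom_contractive pB b' (br_pB_hom _ _ g)).
  pose proof (norm_mul D (pA a) (sub (mul (pA a') w) (mul w (pB b')))) as N1.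
  pose proof (norm_mul D (sub (mul (pA a) w) (mul w (pB b))) (pB b')) as N2.
  assert (norm (pA a) * norm (sub (mul (pA a') w) (mul w (pB b'))) <= K * (l' * s))
    by (apply Rmult_le_compat; auto using norm_nonneg; lra).
  assert (norm (sub (mul (pA a) w) (mul w (pB b))) * norm (pB b') <= (l * s) * K')
    by (apply Rmult_le_compat; auto using norm_nonneg; lra).
  lra.
Qed.

(** The surplus in K and K' makes them dominate |b| and |b'| too, so the Leibniz inequalities in X
    and Y give a common level. [bridge_mul] enters in both orders of the factors, as the Jordan and
    Lie products do. *)
Lemma bridge_leibniz a b l a' b' l' K K' : bridge_rel a b l -> bridge_rel a' b' l' ->
  norm a + 2 * l * s <= K -> norm a' + 2 * l' * s <= K' ->
  bridge_rel (jordan a a') (jordan b b') (K * l' + K' * l) /\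
  bridge_rel (lie a a') (lie b b') (K * l' + K' * l).
Proof.
  intros H H' HK HK'.
  assert (P : 0 <= l * s) by (eapply Rle_trans; [|apply H]; apply norm_nonneg).
  assert (P' : 0 <= l' * s) by (eapply Rle_trans; [|apply H']; apply norm_nonneg).
  pose proof (bridge_norm_r _ _ _ H) as N. pose proof (bridge_norm_r _ _ _ H') as N'.
  destruct (lip_le_leibniz X a a' l l' K K') as [J1 L1]; try apply H; try apply H'; try lra.
  destruct (lip_le_leibniz Y b b' l l' K K') as [J2 L2]; try apply H; try apply H'; try lra.
  pose proof (bridge_mul _ _ _ _ _ _ K K' H H' ltac:(lra) ltac:(lra)) as M1.
  pose proof (bridge_mul _ _ _ _ _ _ K' K H' H ltac:(lra) ltac:(lra)) as M2.
  rewrite (Rplus_comm (K' * l)) in M2.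
  set (u := sub (mul (mul (pA a) (pA a')) w) (mul w (mul (pB b) (pB b')))) in *.
  set (v := sub (mul (mul (pA a') (pA a)) w) (mul w (mul (pB b') (pB b)))) in *.
  split; (split; [auto|split; [auto|]]).
  - unfold pA, pB. rewrite !hom_jordan by apply g. fold pA pB. unfold jordan.
    replace (sub _ _) with (rsmul (/2) (add u v)) by (unfold u, v; nc).
    now apply norm_half_combination.
  - unfold pA, pB. rewrite !hom_lie by apply g. fold pA pB. unfold lie.
    replace (sub _ _) with (smul (mkC 0 (-(/2))) (sub u v)) by (unfold u, v; nc).
    now apply norm_half_combination.
Qed.

Lemma bridge_correspondence : correspondence X Y s bridge_rel.
Proof.
  split.
  - destruct (bridge_total_l (rsmul 0 one) 1) as [b [_ [_ H]]].
    + apply lip_le_weaken with 0; [apply lip_le_scalar|lra].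
    + eapply Rle_trans; [apply norm_nonneg|]. rewrite <- (Rmult_1_l s). exact H.
  - intros a b l H; apply H.
  - intros a b l H; apply H.
  - apply bridge_total_l.
  - apply bridge_total_r.
  - apply bridge_norm_l.
  - apply bridge_norm_r.
  - intros a b l a' b' l' [H1 [H2 H3]] [H1' [H2' H3']]. split; [|split].
    + apply lip_le_add; auto. apply lqcms_prop.
    + apply lip_le_add; auto. apply lqcms_prop.
    + unfold pA, pB. destruct (br_pA_hom _ _ g) as [E _]. destruct (br_pB_hom _ _ g) as [E' _].
      rewrite E, E'. fold pA pB.
      replace (sub _ _) with (add (sub (mul (pA a) w) (mul w (pB b)))
                                  (sub (mul (pA a') w) (mul w (pB b')))) by nc.
      eapply Rle_trans; [apply norm_triangle|]. lra.
  - intros t a b l. apply bridge_rel_rsmul.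
  - intros a b l a' b' l' K K'. apply bridge_leibniz.
Qed.

End BridgeCorrespondence.

Lemma trek_correspondence (X Y : LQCMS) (r : R) : trek_le X Y r ->
  forall s, r < s -> exists T, correspondence X Y s T.
Proof.
  induction 1 as [X Y g r Hg|X Y Z g r s0 Hg _ IH]; intros s Hs.
  - eexists. exact (bridge_correspondence g r s Hg Hs).
  - set (d := (s - (r + s0)) / 2).
    destruct (IH (s0 + d) ltac:(unfold d; lra)) as [V HV].
    assert (Hr : r < r + d) by (unfold d; lra).
    pose proof (bridge_correspondence g r (r + d) Hg Hr) as HT.
    pose proof (correspondence_comp _ _ _ _ _ _ _ HT HV) as H.
    replace (r + d + (s0 + d)) with s in H by (unfold d; lra).
    eexists. exact H.
Qed.

(** * From isometric Jordan-Lie relations to a *-isomorphism *)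

(** A relation rather than a map: it is symmetric in A and B and may be defined on a subspace only.
    Single-valuedness follows from [jl_norm] applied to differences. *)
Record jl_relation {A B : CStarAlg} (H : A -> B -> Prop) : Prop := {
  jl_selfadj_l : forall a b, H a b -> selfadj a;
  jl_selfadj_r : forall a b, H a b -> selfadj b;
  jl_norm : forall a b, H a b -> norm a = norm b;
  jl_add : forall a b a' b', H a b -> H a' b' -> H (add a a') (add b b');
  jl_rsmul : forall r a b, H a b -> H (rsmul r a) (rsmul r b);
  jl_jordan : forall a b a' b', H a b -> H a' b' -> H (jordan a a') (jordan b b');
  jl_lie : forall a b a' b', H a b -> H a' b' -> H (lie a a') (lie b b')
}.

Lemma jl_sub {A B : CStarAlg} (H : A -> B -> Prop) a b a' b' : jl_relation H ->
  H a b -> H a' b' -> H (sub a a') (sub b b').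
Proof.
  intros HH H1 H2. apply (jl_rsmul H HH (-1)) in H2.
  replace (sub a a') with (add a (rsmul (-1) a')) by nc.
  replace (sub b b') with (add b (rsmul (-1) b')) by nc. now apply jl_add.
Qed.

Lemma jl_zero {A B : CStarAlg} (H : A -> B -> Prop) a b : jl_relation H ->
  H a b -> H zero zero.
Proof.
  intros HH H1. apply (jl_rsmul H HH 0) in H1.
  now replace (rsmul 0 a) with (@zero A) in H1 by nc;
  replace (rsmul 0 b) with (@zero B) in H1 by nc.
Qed.

Lemma jl_sym {A B : CStarAlg} (H : A -> B -> Prop) : jl_relation H ->
  jl_relation (fun b a => H a b).
Proof.
  intros HH. split; intros.
  - eapply jl_selfadj_r; eauto.
  - eapply jl_selfadj_l; eauto.
  - symmetry; eapply jl_norm; eauto.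
  - now apply jl_add.
  - now apply jl_rsmul.
  - now apply jl_jordan.
  - now apply jl_lie.
Qed.

Lemma cvg_norm_compare {F : (nat -> Prop) -> Prop} (FF : nat_filter F) {A B : CStarAlg}
  (u : nat -> A) (v : nat -> B) (a : A) (b : B) : cvg F u a -> cvg F v b ->
  (forall eps, 0 < eps -> F (fun n => norm (u n) <= norm (v n) + eps)) -> norm a <= norm b.
Proof.
  intros Hu Hv H. apply Rnot_lt_le. intros L. set (e := (norm a - norm b) / 3).
  assert (He : 0 < e) by (unfold e; lra).
  destruct (nf_ex F FF _ (nf_and F FF _ _ (Hu e He) (nf_and F FF _ _ (Hv e He) (H e He))))
    as [n [H1 [H2 H3]]].
  pose proof (norm_le_sub a (u n)) as T1. rewrite (norm_sub_sym a) in T1.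
  pose proof (norm_le_sub (v n) b) as T2. unfold e in *. lra.
Qed.

Lemma cvg_jordan {F : (nat -> Prop) -> Prop} (FF : nat_filter F) {A : CStarAlg}
  (u v : nat -> A) (a b : A) : cvg F u a -> cvg F v b ->
  cvg F (fun n => jordan (u n) (v n)) (jordan a b).
Proof.
  intros Hu Hv. apply cvg_smul; auto. apply cvg_add; auto; now apply cvg_mul.
Qed.

Lemma cvg_lie {F : (nat -> Prop) -> Prop} (FF : nat_filter F) {A : CStarAlg}
  (u v : nat -> A) (a b : A) : cvg F u a -> cvg F v b ->
  cvg F (fun n => lie (u n) (v n)) (lie a b).
Proof.
  intros Hu Hv. apply cvg_smul; auto. apply cvg_sub; auto; now apply cvg_mul.
Qed.

Lemma cvg_selfadj {F : (nat -> Prop) -> Prop} (FF : nat_filter F) {A : CStarAlg}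
  (u : nat -> A) (a : A) : cvg F u a -> (forall n, selfadj (u n)) -> selfadj a.
Proof.
  intros Hu S. apply (cvg_unique FF u); auto.
  apply (cvg_ext FF (fun n => star (u n))); [apply S|now apply cvg_star].
Qed.

Section Closure.
Context {A B : CStarAlg} (H : A -> B -> Prop) (HH : jl_relation H).

Definition rel_closure (a : A) (b : B) : Prop := exists u v,
  (forall n, H (u n) (v n)) /\ cvg eventually u a /\ cvg eventually v b.

Lemma rel_closure_jl : jl_relation rel_closure.
Proof.
  pose proof eventually_filter as EF. split.
  - intros a b [u [v [Huv [Hu Hv]]]]. apply (cvg_selfadj EF u); auto.
    intros n. eapply jl_selfadj_l; eauto.
  - intros a b [u [v [Huv [Hu Hv]]]]. apply (cvg_selfadj EF v); auto.
    intros n. eapply jl_selfadj_r; eauto.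
  - intros a b [u [v [Huv [Hu Hv]]]].
    apply Rle_antisym; [apply (cvg_norm_compare EF u v)|apply (cvg_norm_compare EF v u)]; auto;
    intros eps He; apply (nf_forall EF); intros n; rewrite (jl_norm H HH _ _ (Huv n)); lra.
  - intros a b a' b' [u [v [Huv [Hu Hv]]]] [u' [v' [Huv' [Hu' Hv']]]].
    exists (fun n => add (u n) (u' n)), (fun n => add (v n) (v' n)).
    split; [intros; now apply jl_add|split; now apply cvg_add].
  - intros r a b [u [v [Huv [Hu Hv]]]].
    exists (fun n => rsmul r (u n)), (fun n => rsmul r (v n)).
    split; [intros; now apply jl_rsmul|split; now apply cvg_smul].
  - intros a b a' b' [u [v [Huv [Hu Hv]]]] [u' [v' [Huv' [Hu' Hv']]]].
    exists (fun n => jordan (u n) (u' n)), (fun n => jordan (v n) (v' n)).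
    split; [intros; now apply jl_jordan|split; now apply cvg_jordan].
  - intros a b a' b' [u [v [Huv [Hu Hv]]]] [u' [v' [Huv' [Hu' Hv']]]].
    exists (fun n => lie (u n) (u' n)), (fun n => lie (v n) (v' n)).
    split; [intros; now apply jl_lie|split; now apply cvg_lie].
Qed.

Lemma rel_closure_incl a b : H a b -> rel_closure a b.
Proof.
  intros Hab. exists (fun _ => a), (fun _ => b).
  split; [auto|split; apply cvg_const, eventually_filter].
Qed.

(** The approximants of a form a Cauchy sequence, and the relation is isometric on differences, so
    their partners form one as well. *)
Lemma rel_closure_total a :
  (forall eps, 0 < eps -> exists a' b', H a' b' /\ norm (sub a a') < eps) ->
  exists b, rel_closure a b.
Proof.
  intros Ha.
  destruct (choice (fun n (p : A * B) => H (fst p) (snd p) /\ norm (sub a (fst p)) < / (INR n + 1)))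
    as [p Hp].
  { intros n. destruct (Ha _ (inv_INR_pos n)) as [a' [b' [H1 H2]]]. now exists (a', b'). }
  assert (Hu : cvg eventually (fun n => fst (p n)) a).
  { intros eps He. apply (nf_mono _ eventually_filter) with (2 := inv_INR_small eps He).
    intros n Hn. destruct (Hp n) as [_ H2]. rewrite norm_sub_sym. lra. }
  destruct (complete B (fun n => snd (p n))) as [b Hb].
  { intros eps He. destruct (Hu (eps / 2) ltac:(lra)) as [N HN]. exists N.
    intros m n Hm Hn. fold (sub (snd (p m)) (snd (p n))).
    rewrite <- (jl_norm H HH (sub (fst (p m)) (fst (p n)))).
    - pose proof (norm_sub_triangle (fst (p m)) a (fst (p n))) as T.
      rewrite (norm_sub_sym a) in T. pose proof (HN m Hm). pose proof (HN n Hn). lra.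
    - apply jl_sub; auto; apply Hp. }
  exists b, (fun n => fst (p n)), (fun n => snd (p n)).
  split; [intros n; apply Hp|split; auto].
Qed.

End Closure.

Section Complexification.
Context {A B : CStarAlg} (H : A -> B -> Prop) (HH : jl_relation H).

Definition rel_complex (x : A) (y : B) : Prop := exists a b c d, H a b /\ H c d /\
  x = add a (smul Ci c) /\ y = add b (smul Ci d).

Lemma rel_complex_incl a b : H a b -> rel_complex a b.
Proof.
  intros Hab. exists a, b, zero, zero. split; [auto|split].
  - eapply jl_zero; eauto.
  - split; nc.
Qed.

Lemma rel_complex_add x y x' y' : rel_complex x y -> rel_complex x' y' ->
  rel_complex (add x x') (add y y').
Proof.
  intros [a [b [c [d [H1 [H2 [-> ->]]]]]]] [a' [b' [c' [d' [H1' [H2' [-> ->]]]]]]].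
  exists (add a a'), (add b b'), (add c c'), (add d d').
  split; [now apply jl_add|split; [now apply jl_add|split; nc]].
Qed.

Lemma rel_complex_smul k x y : rel_complex x y -> rel_complex (smul k x) (smul k y).
Proof.
  intros [a [b [c [d [H1 [H2 [-> ->]]]]]]].
  exists (add (rsmul (re k) a) (rsmul (- im k) c)), (add (rsmul (re k) b) (rsmul (- im k) d)),
    (add (rsmul (re k) c) (rsmul (im k) a)), (add (rsmul (re k) d) (rsmul (im k) b)).
  split; [|split; [|split; nc]]; apply jl_add; auto; now apply jl_rsmul.
Qed.

Lemma rel_complex_star x y : rel_complex x y -> rel_complex (star x) (star y).
Proof.
  intros [a [b [c [d [H1 [H2 [-> ->]]]]]]].
  pose proof (jl_selfadj_l H HH _ _ H1). pose proof (jl_selfadj_l H HH _ _ H2).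
  pose proof (jl_selfadj_r H HH _ _ H1). pose proof (jl_selfadj_r H HH _ _ H2).
  exists a, b, (rsmul (-1) c), (rsmul (-1) d).
  split; [auto|split; [now apply jl_rsmul|split; nc]].
Qed.

(** The real and imaginary parts of a product of self-adjoint elements are its Jordan and Lie
    products. *)
Lemma rel_complex_mul_selfadj a b a' b' : H a b -> H a' b' ->
  rel_complex (mul a a') (mul b b').
Proof.
  intros H1 H2. exists (jordan a a'), (jordan b b'), (lie a a'), (lie b b').
  split; [now apply jl_jordan|split; [now apply jl_lie|]].
  unfold jordan, lie. split; nc.
Qed.

Lemma rel_complex_mul x y x' y' : rel_complex x y -> rel_complex x' y' ->
  rel_complex (mul x x') (mul y y').
Proof.
  intros [a [b [c [d [H1 [H2 [-> ->]]]]]]] [a' [b' [c' [d' [H1' [H2' [-> ->]]]]]]].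
  replace (mul (add a (smul Ci c)) (add a' (smul Ci c'))) with
    (add (add (mul a a') (smul (CofR (-1)) (mul c c')))
         (add (smul Ci (mul a c')) (smul Ci (mul c a')))) by nc.
  replace (mul (add b (smul Ci d)) (add b' (smul Ci d'))) with
    (add (add (mul b b') (smul (CofR (-1)) (mul d d')))
         (add (smul Ci (mul b d')) (smul Ci (mul d b')))) by nc.
  repeat apply rel_complex_add; try apply rel_complex_smul; now apply rel_complex_mul_selfadj.
Qed.

Lemma rel_complex_zero y : rel_complex zero y -> y = zero.
Proof.
  intros [a [b [c [d [H1 [H2 [E ->]]]]]]].
  pose proof (jl_selfadj_l H HH _ _ H1). pose proof (jl_selfadj_l H HH _ _ H2).
  assert (a = zero).
  { assert (G : zero = rsmul (/2) (add (add a (smul Ci c)) (star (add a (smul Ci c)))))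
      by (rewrite <- E; nc).
    rewrite G. nc. }
  assert (c = zero).
  { subst a. nc_from (f_equal (smul Ci) E). }
  subst a c.
  assert (b = zero) as -> by (apply norm_eq0; now rewrite <- (jl_norm H HH _ _ H1), norm_zero).
  assert (d = zero) as -> by (apply norm_eq0; now rewrite <- (jl_norm H HH _ _ H2), norm_zero).
  nc.
Qed.

Lemma rel_complex_fun x y y' : rel_complex x y -> rel_complex x y' -> y = y'.
Proof.
  intros H1 H2. apply (rel_complex_smul (CofR (-1))) in H2.
  pose proof (rel_complex_add _ _ _ _ H1 H2) as H3.
  replace (add x (smul (CofR (-1)) x)) with (@zero A) in H3 by nc.
  apply rel_complex_zero in H3. nc_from H3.
Qed.

Lemma rel_complex_total x : (forall a, selfadj a -> exists b, H a b) ->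
  exists y, rel_complex x y.
Proof.
  intros Ht. destruct (Ht _ (re_part_selfadj x)) as [b Hb].
  destruct (Ht _ (im_part_selfadj x)) as [d Hd].
  exists (add b (smul Ci d)), (re_part x), b, (im_part x), d.
  split; [auto|split; [auto|split; [apply re_im_part|reflexivity]]].
Qed.

End Complexification.

Lemma rel_complex_sym {A B : CStarAlg} (H : A -> B -> Prop) x y :
  rel_complex H x y -> rel_complex (fun b a => H a b) y x.
Proof.
  intros [a [b [c [d [H1 [H2 [-> ->]]]]]]]. exists b, a, d, c. auto.
Qed.

(** Injectivity and surjectivity are single-valuedness and totality of the converse relation, which
    satisfies the same axioms. *)
Lemma jl_star_iso {A B : CStarAlg} (H : A -> B -> Prop) : jl_relation H ->
  (forall a, selfadj a -> exists b, H a b) -> (forall b, selfadj b -> exists a, H a b) ->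
  exists h : A -> B, star_iso h /\ forall a b, H a b -> h a = b.
Proof.
  intros HH Hl Hr. pose proof (jl_sym H HH) as HS.
  destruct (choice (rel_complex H)) as [h Hh].
  { intros x. now apply rel_complex_total. }
  pose proof (rel_complex_fun H HH) as Fun.
  exists h. split; [repeat split|].
  - intros x y. apply (Fun (add x y)); auto. now apply rel_complex_add.
  - intros c x. apply (Fun (smul c x)); auto. now apply rel_complex_smul.
  - intros x y. apply (Fun (mul x y)); auto. now apply rel_complex_mul.
  - intros x. apply (Fun (star x)); auto. now apply rel_complex_star.
  - intros x y E. apply (rel_complex_fun _ HS (h x)); [|rewrite E];
    apply rel_complex_sym, Hh.
  - intros y. destruct (rel_complex_total (fun b a => H a b) y Hr) as [x Hx].
    exists x. apply (Fun x); auto. now apply rel_complex_sym in Hx.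
  - intros a b Hab. apply (Fun a); auto. now apply rel_complex_incl.
Qed.

(** * The limit of correspondences *)

Section Limit.
Context {U : (nat -> Prop) -> Prop} (FU : nat_filter U)
  (UU : forall P, U P \/ U (fun n => ~ P n)) (UE : forall P, eventually P -> U P)
  {X Y : LQCMS} (T : nat -> X -> Y -> R -> Prop)
  (HT : forall n, correspondence X Y (/ (INR n + 1)) (T n)).

(** Both sequences vary because totality on the left keeps [u] constant and totality on the right
    keeps [v] constant, while sums and products mix the two kinds. The uniform [K] keeps the level
    of products independent of n. *)
Definition limit_rel (a : X) (b : Y) : Prop := exists l K u v,
  (forall n, T n (u n) (v n) l /\ norm (u n) <= K) /\ cvg U u a /\ cvg U v b.

Lemma inv_INR_le_1 n : / (INR n + 1) <= 1.
Proof.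
  rewrite <- Rinv_1. apply Rinv_le_contravar; [lra|]. pose proof (pos_INR n). lra.
Qed.

Lemma corr_level_nonneg n a b l : T n a b l -> 0 <= l.
Proof.
  intros H. apply (corr_lip_l _ _ _ _ (HT n)) in H.
  eapply lip_le_nonneg; [apply lqcms_prop|eauto].
Qed.

Lemma eventually_defect_small l eps : 0 <= l -> 0 < eps ->
  U (fun n => 2 * l * / (INR n + 1) <= eps).
Proof.
  intros Hl He. assert (Hd : 0 < eps / (2 * l + 1)) by (apply Rdiv_lt_0_compat; lra).
  apply UE, (nf_mono _ eventually_filter) with (2 := inv_INR_small _ Hd). intros n Hn.
  pose proof (inv_INR_pos n). apply Rle_trans with ((2 * l + 1) * / (INR n + 1)); [nra|].
  apply Rlt_le. apply Rmult_lt_compat_l with (r := 2 * l + 1) in Hn; [|lra].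
  replace ((2 * l + 1) * (eps / (2 * l + 1))) with eps in Hn by (field; lra). exact Hn.
Qed.

Lemma limit_rel_jl : jl_relation limit_rel.
Proof.
  (* Since 1/(n+1) <= 1, the bound K + 2l meets the Leibniz clause for every n at once. *)
  assert (LB : forall n a b l K, T n a b l -> norm a <= K ->
    norm a + 2 * l * / (INR n + 1) <= K + 2 * l).
  { intros n a b l K H HK. pose proof (corr_level_nonneg _ _ _ _ H).
    pose proof (inv_INR_le_1 n). pose proof (inv_INR_pos n). nra. }
  assert (NB : forall (a a' : X) K K', norm a <= K -> norm a' <= K' ->
    norm (jordan a a') <= K * K' /\ norm (lie a a') <= K * K').
  { intros a a' K K' H H'.
    apply norm_half_combination; (eapply Rle_trans; [apply norm_mul|]).
    - apply Rmult_le_compat; auto using norm_nonneg.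
    - rewrite Rmult_comm. apply Rmult_le_compat; auto using norm_nonneg. }
  split.
  - intros a b [l [K [u [v [Huv [Hu Hv]]]]]]. apply (cvg_selfadj FU u); auto.
    intros n. eapply lip_le_selfadj; [apply lqcms_prop|].
    eapply (corr_lip_l _ _ _ _ (HT n)). apply Huv.
  - intros a b [l [K [u [v [Huv [Hu Hv]]]]]]. apply (cvg_selfadj FU v); auto.
    intros n. eapply lip_le_selfadj; [apply lqcms_prop|].
    eapply (corr_lip_r _ _ _ _ (HT n)). apply Huv.
  - intros a b [l [K [u [v [Huv [Hu Hv]]]]]].
    pose proof (corr_level_nonneg _ _ _ _ (proj1 (Huv O))) as Hl.
    apply Rle_antisym; [apply (cvg_norm_compare FU u v)|apply (cvg_norm_compare FU v u)]; auto;
    intros eps He; apply (nf_mono _ FU) with (2 := eventually_defect_small l eps Hl He);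
    intros n Hn; destruct (Huv n) as [HTn _].
    + pose proof (corr_norm_l _ _ _ _ (HT n) _ _ _ HTn). lra.
    + pose proof (corr_norm_r _ _ _ _ (HT n) _ _ _ HTn). lra.
  - intros a b a' b' [l [K [u [v [Huv [Hu Hv]]]]]] [l' [K' [u' [v' [Huv' [Hu' Hv']]]]]].
    exists (l + l'), (K + K'), (fun n => add (u n) (u' n)), (fun n => add (v n) (v' n)).
    split; [|split; now apply cvg_add].
    intros n. destruct (Huv n) as [H1 H2]. destruct (Huv' n) as [H1' H2'].
    split; [now apply (corr_add _ _ _ _ (HT n))|].
    pose proof (norm_triangle X (u n) (u' n)). lra.
  - intros r a b [l [K [u [v [Huv [Hu Hv]]]]]].
    exists (Rabs r * l), (Rabs r * K), (fun n => rsmul r (u n)), (fun n => rsmul r (v n)).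
    split; [|split; now apply cvg_smul].
    intros n. destruct (Huv n) as [H1 H2].
    split; [now apply (corr_rsmul _ _ _ _ (HT n))|].
    rewrite norm_rsmul. apply Rmult_le_compat_l; auto. apply Rabs_pos.
  - intros a b a' b' [l [K [u [v [Huv [Hu Hv]]]]]] [l' [K' [u' [v' [Huv' [Hu' Hv']]]]]].
    exists ((K + 2 * l) * l' + (K' + 2 * l') * l), (K * K'),
      (fun n => jordan (u n) (u' n)), (fun n => jordan (v n) (v' n)).
    split; [|split; now apply cvg_jordan].
    intros n. destruct (Huv n) as [H1 H2]. destruct (Huv' n) as [H1' H2'].
    split; [|now apply NB].
    eapply (corr_leibniz _ _ _ _ (HT n)); eauto.
  - intros a b a' b' [l [K [u [v [Huv [Hu Hv]]]]]] [l' [K' [u' [v' [Huv' [Hu' Hv']]]]]].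
    exists ((K + 2 * l) * l' + (K' + 2 * l') * l), (K * K'),
      (fun n => lie (u n) (u' n)), (fun n => lie (v n) (v' n)).
    split; [|split; now apply cvg_lie].
    intros n. destruct (Huv n) as [H1 H2]. destruct (Huv' n) as [H1' H2'].
    split; [|now apply NB].
    eapply (corr_leibniz _ _ _ _ (HT n)); eauto.
Qed.

Lemma defect_le n a b l : T n a b l -> 2 * l * / (INR n + 1) <= 2 * l.
Proof.
  intros H. pose proof (corr_level_nonneg _ _ _ _ H).
  pose proof (inv_INR_le_1 n). nra.
Qed.

(** The partner stays at the same level l, by closedness of Lipschitz balls; this is what preserves
    the exact value of the Lip-norm. *)
Lemma limit_rel_total_l a l : lip_le (lip X) a l ->
  exists b, limit_rel a b /\ lip_le (lip Y) b l.
Proof.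
  intros Ha.
  destruct (choice (fun n b => T n a b l)) as [v Hv].
  { intros n. now apply (corr_total_l _ _ _ _ (HT n)). }
  assert (Lv : forall n, lip_le (lip Y) (v n) l)
    by (intros n; now apply (corr_lip_r _ _ _ _ (HT n) a)).
  destruct (lip_ball_ultra_limit FU UU (lip Y) (lqcms_prop Y) UE v l (norm a + 2 * l))
    as [b Hb]; auto.
  { intros n. pose proof (corr_norm_r _ _ _ _ (HT n) _ _ _ (Hv n)).
    pose proof (defect_le _ _ _ _ (Hv n)). lra. }
  exists b. split.
  - exists l, (norm a), (fun _ => a), v. split; [|split; auto; now apply cvg_const].
    intros n. split; [auto|lra].
  - now apply (lip_le_ultra_limit FU (lip Y) (lqcms_prop Y) v).
Qed.

Lemma limit_rel_total_r b l : lip_le (lip Y) b l ->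
  exists a, limit_rel a b /\ lip_le (lip X) a l.
Proof.
  intros Hb.
  destruct (choice (fun n a => T n a b l)) as [u Hu].
  { intros n. now apply (corr_total_r _ _ _ _ (HT n)). }
  assert (Lu : forall n, lip_le (lip X) (u n) l)
    by (intros n; now apply (corr_lip_l _ _ _ _ (HT n) _ b)).
  assert (Nu : forall n, norm (u n) <= norm b + 2 * l).
  { intros n. pose proof (corr_norm_l _ _ _ _ (HT n) _ _ _ (Hu n)).
    pose proof (defect_le _ _ _ _ (Hu n)). lra. }
  destruct (lip_ball_ultra_limit FU UU (lip X) (lqcms_prop X) UE u l (norm b + 2 * l))
    as [a Ha]; auto.
  exists a. split.
  - exists l, (norm b + 2 * l), u, (fun _ => b). split; [|split; auto; now apply cvg_const].
    intros n. split; auto.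
  - now apply (lip_le_ultra_limit FU (lip X) (lqcms_prop X) u).
Qed.

Lemma lip_dense (Z : LQCMS) (a : Z) : selfadj a -> forall eps, 0 < eps ->
  exists a' l, lip_le (lip Z) a' l /\ norm (sub a a') < eps.
Proof.
  intros Sa eps He. destruct (lqcms_prop Z) as [_ [_ [_ [_ [Hd _]]]]].
  destruct (Hd a Sa eps He) as [a' [Ha' Hn]].
  destruct (lip Z a') as [l|] eqn:E; [|easy].
  exists a', l. split; auto. exists l. split; [auto|lra].
Qed.

Lemma limit_isomorphism : exists h : X -> Y, star_iso h /\
  forall a : X, selfadj a -> lip Y (h a) = lip X a.
Proof.
  pose proof limit_rel_jl as HJ. set (H := rel_closure limit_rel).
  pose proof (rel_closure_jl limit_rel HJ : jl_relation H) as HH.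
  assert (TL : forall a : X, selfadj a -> exists b, H a b).
  { intros a Sa. apply rel_closure_total; auto. intros eps He.
    destruct (lip_dense X a Sa eps He) as [a' [l [Ha' Hn]]].
    destruct (limit_rel_total_l a' l Ha') as [b' [Hb' _]]. now exists a', b'. }
  assert (TR : forall b : Y, selfadj b -> exists a, H a b).
  { intros b Sb.
    destruct (rel_closure_total (fun b a => limit_rel a b) (jl_sym _ HJ) b) as [a Hab].
    - intros eps He. destruct (lip_dense Y b Sb eps He) as [b' [l [Hb' Hn]]].
      destruct (limit_rel_total_r b' l Hb') as [a' [Ha' _]]. now exists b', a'.
    - exists a. destruct Hab as [v [u [H1 [H2 H3]]]]. now exists u, v. }
  destruct (jl_star_iso H HH TL TR) as [h [Hiso Hh]].
  exists h. split; auto. intros a Sa.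
  assert (LR : forall l, lip X a = Some l -> lip_le (lip Y) (h a) l).
  { intros l E. destruct (limit_rel_total_l a l) as [b [Hab Lb]].
    - exists l. split; [auto|lra].
    - rewrite (Hh a b); auto. now apply rel_closure_incl. }
  (* The partner a' of h(a) satisfies h(a') = h(a), so injectivity identifies it with a. When the
     Lip-norm of a is infinite, this also excludes a finite value at h(a). *)
  assert (RL : forall m, lip Y (h a) = Some m -> lip_le (lip X) a m).
  { intros m E. destruct (limit_rel_total_r (h a) m) as [a' [Hab La]].
    - exists m. split; [auto|lra].
    - replace a with a'; auto. apply rel_closure_incl, Hh in Hab.
      destruct Hiso as [_ [_ [_ [_ [Hinj _]]]]]. now apply Hinj. }
  destruct (lip X a) as [l|] eqn:E.
  - destruct (LR l eq_refl) as [m [Em Hm]]. destruct (RL m Em) as [l' [El' Hl']].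
    rewrite Em. f_equal. assert (l' = l) by congruence. lra.
  - destruct (lip Y (h a)) as [m|] eqn:E'; auto.
    destruct (RL m eq_refl) as [l' [El' _]]. congruence.
Qed.

End Limit.

Theorem mainTheorem11 (X Y : LQCMS) :
  propinquity_zero X Y ->
  exists h : X -> Y, star_iso h /\
    (forall a : X, selfadj a -> lip Y (h a) = lip X a).
Proof.
  intros H0. destruct ultrafilter_exists as [U [FU [UU UE]]].
  destruct (choice (fun n T => correspondence X Y (/ (INR n + 1)) T)) as [T HT].
  { intros n. destruct (H0 _ (inv_INR_pos n)) as [r [Hr Ht]].
    now apply trek_correspondence with r. }
  exact (limit_isomorphism FU UU UE T HT).
Qed.
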